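(* Let $G$ be a bounded graph with twin subgraphs $X_1$ and $X_2$ (bijection $f$, automorphism $\hat f$), let $T$ be a twin set in $X_1$ with $|T|\ge3$, and let $C=1-\frac{2}{|T|}$. If $a\in T$, then the pair state $\frac1{\sqrt2}(\mathbf e_a-\mathbf e_{\hat f(a)})$ is $C$-sedentary in $G$, and the plus state $\frac1{\sqrt2}(\mathbf e_a+\mathbf e_{\hat f(a)})$ is $C$-sedentary in $\tilde G_D$, where $D$ is any diagonal matrix with $\pm1$ diagonal entries such that $D_a=-D_{\hat f(a)}$ and $\tilde G_D$ is the graph with $A(\tilde G_D)=DA(G)D$.
   Context: A graph has a countable vertex set and symmetric real weights $w(a,b)$, nonzero exactly on edges (no loops); it is bounded if $\sum_b|w(a,b)|^2<\infty$ for each $a$ and the absolute degrees $\sum_b|w(a,b)|$ are uniformly bounded. $A(G)_{a,b}=w(a,b)$, $U_G(t)=\exp(itA(G))$. A unit vector $\mathbf u$ is $C$-sedentary in $G$ ($0<C\le1$) if $\inf_{t>0}|\mathbf u^*U_G(t)\mathbf u|\ge C$. Twin subgraphs: $G$ connected, $X_1,X_2$ vertex-disjoint induced subgraphs with no edges between them, $f:V(X_1)\to V(X_2)$ a bijection with $w(f(a),f(b))=w(a,b)$ for $a,b\in V(X_1)$ and $w(f(a),y)=w(a,y)$ for $a\in V(X_1)$, $y\notin V(X_1)\cup V(X_2)$; $\hat f$ swaps $a$ and $f(a)$ and fixes all other vertices. Vertices $u,v$ of a graph $X$ are twins if $N_X(u)\setminus\{v\}=N_X(v)\setminus\{u\}$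 and $w(x,u)=w(x,v)$ for all $x\in N_X(u)\setminus\{v\}$. A twin set is a maximal vertex subset in which every two vertices are twins. *)

(* Defs.v *)
From HB Require Import structures.
From mathcomp Require Import all_boot all_order all_algebra.
From mathcomp Require Import finmap.
From mathcomp Require Import all_classical all_reals.
From mathcomp Require Import topology normedtype sequences esum exp.
From mathcomp Require Import complex.
Set Implicit Arguments.
Unset Strict Implicit.
Unset Printing Implicit Defensive.
Import Order.TTheory GRing.Theory Num.Theory.
Import ComplexField.

Local Open Scope classical_set_scope.
Local Open Scope complex_scope.
Local Open Scope ring_scope.

(* {a, b} is an edge iff wt a b != 0. *)
Record graph (R : realType) (V : countType) := Graph {
  wt :> V -> V -> R ;
  wt_sym : forall a b, wt a b = wt b a ;
  wt_loopless : forall a, wt a a = 0 }.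

Section GraphNotions.
Variables (R : realType) (V : countType).
Implicit Types (G : graph R V) (X T : set V).

Definition bounded_graph G : Prop :=
  (forall a, (\esum_(b in [set: V]) ((`|G a b| ^+ 2)%:E) < +oo)%E) /\
  (exists M : R, forall a, (\esum_(b in [set: V]) (`|G a b|%:E) <= M%:E)%E).

Definition edge G : rel V := fun a b => G a b != 0.

Definition connected_graph G : Prop :=
  forall a b, exists2 p : seq V, path (edge G) a p & last a p = b.

(* An induced subgraph of G is given by its vertex set X, with the weights
   of G restricted to X. *)
Definition nbhd G X (u : V) : set V := [set x | X x /\ edge G u x].

Definition twins G X (u v : V) : Prop :=
  nbhd G X u `\ v = nbhd G X v `\ u /\
  (forall x, (nbhd G X u `\ v) x -> G x u = G x v).

Definition pairwise_twins G X T : Prop :=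
  T `<=` X /\ (forall u v, T u -> T v -> u <> v -> twins G X u v).

Definition twin_set G X T : Prop :=
  pairwise_twins G X T /\
  (forall T', pairwise_twins G X T' -> T `<=` T' -> T' = T).

(* f matters only on X1, where it is a bijection onto X2. *)
Definition twin_subgraphs G X1 X2 (f : V -> V) : Prop :=
  [/\ connected_graph G,
      X1 `&` X2 = set0 /\ (forall a b, X1 a -> X2 b -> ~~ edge G a b),
      set_bij X1 X2 f,
      (forall a b, X1 a -> X1 b -> G (f a) (f b) = G a b) &
      (forall a y, X1 a -> ~ (X1 `|` X2) y -> G (f a) y = G a y)].

Definition hat X1 X2 (f : V -> V) (v : V) : V :=
  if v \in X1 then f v else if v \in X2 then 'pinv_id X1 f v else v.

(* The graph with adjacency matrix D A(G) D, where D is the diagonal matrix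
   with entries D a. *)
Definition diag_conj_wt (D : V -> R) G (a b : V) : R := D a * G a b * D b.

Lemma diag_conj_sym D G a b : diag_conj_wt D G a b = diag_conj_wt D G b a.
Proof. by rewrite /diag_conj_wt (wt_sym G a b) mulrC [D a * _]mulrC mulrA. Qed.

Lemma diag_conj_loopless D G a : diag_conj_wt D G a a = 0.
Proof. by rewrite /diag_conj_wt wt_loopless mulr0 mul0r. Qed.

Definition diag_conj (D : V -> R) G : graph R V :=
  Graph (@diag_conj_sym D G) (@diag_conj_loopless D G).

(* 1 / |T|, read as 0 when T is infinite. *)
Definition inv_card T : R :=
  if `[< finite_set T >] then (#|` fset_set T|)%:R^-1 else 0.

End GraphNotions.

Section Evolution.
Variables (R : realType) (V : countType).
Local Notation C := R[i].
Local Notation vec := (V -> C).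
Local Notation op := (vec -> vec).

(* Sums over V of absolutely summable families (the value is meaningless
   for other families). *)
Definition rsum (h : V -> R) : R :=
  fine (\esum_(a in [set: V]) (Num.max (h a) 0)%:E -
        \esum_(a in [set: V]) (Num.max (- h a) 0)%:E)%E.

Definition csum (h : vec) : C :=
  rsum (fun a => complex.Re (h a)) +i* rsum (fun a => complex.Im (h a)).

Definition l2norm (x : vec) : \bar R :=
  ((\esum_(a in [set: V]) ((Normc.normc (x a) ^+ 2)%:E)) `^ 2^-1)%E.

Definition l2 : set vec := [set x | (l2norm x < +oo)%E].

Definition cdot (x y : vec) : C := csum (fun a => conjc (x a) * y a).

Definition adj_op (G : graph R V) : op :=
  fun x a => csum (fun b => (G a b)%:C * x b).

(* Convergence in the operator norm of l2. *)
Definition op_cvg (S : nat -> op) (B : op) : Prop :=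
  forall e : R, 0 < e ->
    \forall n \near \oo, forall x, l2 x ->
      (l2norm (fun a => S n x a - B x a)%R <= e%:E * l2norm x)%E.

Definition exp_partial (B : op) (n : nat) : op :=
  fun x a => \sum_(k < n) (k`!%:R)^-1 * iter k B x a.

(* Only the values on l2 are meaningful: there, the operator-norm limit of the
   exponential series is unique. *)
Definition op_exp (B : op) : op := xget (id : op) [set E : op | op_cvg (exp_partial B) E].

Definition evolution (G : graph R V) (t : R) : op :=
  op_exp (fun x a => (0 +i* t) * adj_op G x a).

Definition sedentary (G : graph R V) (c : R) (u : vec) : Prop :=
  [/\ 0 < c <= 1, l2norm u = 1%E &
      c <= inf [set Normc.normc (cdot u (evolution G t u)) |
                t in [set t : R | 0 < t]]].

Definition evec (a : V) : vec := fun v => (v == a)%:R.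

Definition pair_state (a b : V) : vec :=
  fun v => (Num.sqrt 2)^-1%:C * (evec a v - evec b v).

Definition plus_state (a b : V) : vec :=
  fun v => (Num.sqrt 2)^-1%:C * (evec a v + evec b v).

End Evolution.
Arguments inv_card {R V} T.
Arguments pair_state {R V} a b.
Arguments plus_state {R V} a b.

(* Main.v *)
Require Import Defs.
From HB Require Import structures.
From mathcomp Require Import all_boot all_order all_algebra.
From mathcomp Require Import finmap.
From mathcomp Require Import all_classical all_reals.
From mathcomp Require Import ereal topology normedtype sequences esum exp numfun.
From mathcomp Require Import complex.
From mathcomp Require Import ring lra.
Set Implicit Arguments.
Unset Strict Implicit.
Unset Printing Implicit Defensive.
Import Order.TTheory GRing.Theory Num.Theory.
Import ComplexField numFieldNormedType.Exports.

Local Open Scope classical_set_scope.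
Local Open Scope ring_scope.

(** A pair state [u] at a twin [a] splits as [p + q], where [p] averages the
    vectors [e_b - e_(f b)] over finitely many twins [b] of [a]. The part [q] is
    an eigenvector of the adjacency operator and orthogonal to [p], and
    [|p|^2 = 1/m] for [m] twins. As the evolution is unitary,
    [|<u, U u>| >= |q|^2 - |<p, U p>| >= 1 - 2/m]; an infinite twin set is
    exhausted by finite ones.

    Unitarity is only needed for [|<p, U p>| <= |p|^2], and it is read off the
    moments [mu_k = <p, A^k p>]: the exponential series truncated at [n] maps
    [p] to a vector whose squared norm is a combination of the [mu_(j+k)], which
    tends to [mu_0] because [exp(itz) exp(-itz) = 1] as power series. All these
    vectors are in l1, which is stable under [A]. The plus state on the
    conjugated graph has the same moments as the pair state. *)

(** Write d_b = e_b - e_(f b). Outside X1 and X2 every A d_b vanishes, because b and f b have the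
    same weights there. Inside, a vertex other than b, b' and their images sees the two twins
    equally, so A(d_b - d_b') lives on these four vertices and equals -G b b' times d_b - d_b'. The
    weight G a b is the same for all twins b of a, so all differences d_a - d_b share one
    eigenvalue, and q inherits it. In 1 - 2/m one 1/m is missing from |q|^2, the other is the worst
    case of p.

    The definitions shape the rest. [op_exp] picks some limit of the exponential series by [xget],
    so l2 estimates must show that a limit exists; afterwards only coordinates at the finitely many
    vertices of the state matter. [rsum] is meaningful for absolutely summable families only, and l1
    keeps every family in sight summable. Twin vectors are real, hence so are their moments; complex
    numbers enter only as coefficients of the series. *)

(** * Sums of nonnegative families and Schur's test *)

Section Esum.
Variable R : realType.
Local Open Scope ereal_scope.

Lemma esumZl (I : choiceType) (c : R) (h : I -> \bar R) : (0 <= c)%R ->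
  (forall i, 0 <= h i) ->
  \esum_(i in [set: I]) (c%:E * h i) = c%:E * \esum_(i in [set: I]) h i.
Proof.
move=> c0 h0.
have le d (g : I -> \bar R) : (0 <= d)%R -> (forall i, 0 <= g i) ->
    \esum_(i in [set: I]) (d%:E * g i) <= d%:E * \esum_(i in [set: I]) g i.
  move=> d0 g0; apply: ge_ereal_sup => _ [X [finX XI]] <-.
  rewrite -ge0_mule_fsumr//; apply: lee_wpmul2l; rewrite ?lee_fin//.
  by apply: ereal_sup_ubound; exists X.
have [->|cn0] := eqVneq c 0%R.
  by rewrite mul0e esum1// => i _; rewrite mul0e.
apply/eqP; rewrite eq_le le//=.
have ch0 i : 0 <= c%:E * h i by rewrite mule_ge0// lee_fin.
have := le c^-1%R _ _ ch0; rewrite invr_ge0 => /(_ c0).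
under eq_esum do rewrite muleA -EFinM mulVf// mul1e.
have cE0 : 0 <= c%:E by rewrite lee_fin.
by move=> /(lee_wpmul2l cE0); rewrite muleA -EFinM mulfV// mul1e.
Qed.

Lemma esum_swap (I J : choiceType) (h : I -> J -> \bar R) :
  (forall i j, 0 <= h i j) ->
  \esum_(i in [set: I]) \esum_(j in [set: J]) h i j =
  \esum_(j in [set: J]) \esum_(i in [set: I]) h i j.
Proof.
move=> h0; rewrite !esum_esum//.
rewrite (@reindex_esum R _ _ ([set: J] `*`` fun=> [set: I]) _ (fun x => (x.2, x.1)))//.
split => //=.
- by move=> [i1 j1] [i2 j2] _ _ /= [-> ->].
- by move=> [i j] _; exists (j, i).
Qed.

Lemma esum_ge_term (I : choiceType) (h : I -> \bar R) i :
  (forall i, 0 <= h i) -> h i <= \esum_(i in [set: I]) h i.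
Proof.
move=> h0; apply: esum_ge; exists [set i]; first by split.
by rewrite fsbig_set1.
Qed.

(** Summing w (l - z)^2 >= 0 gives 2 l Z <= l^2 M + S for every l >= 0. The choice l = 1 shows that
    Z is finite when S is, and l = Z / M is optimal. *)
Lemma esum_jensen (I : choiceType) (w z : I -> R) (M : R) : (0 < M)%R ->
  (forall i, 0 <= w i)%R -> (forall i, 0 <= z i)%R ->
  \esum_(i in [set: I]) (w i)%:E <= M%:E ->
  (\esum_(i in [set: I]) (w i * z i)%:E) ^+ 2 <=
    M%:E * \esum_(i in [set: I]) (w i * z i ^+ 2)%:E.
Proof.
move=> M0 w0 z0 wM.
set S := \esum_(i in _) (w i * z i ^+ 2)%:E.
have wz20 i : 0 <= (w i * z i ^+ 2)%:E by rewrite lee_fin mulr_ge0// sqr_ge0.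
have wz0 i : 0 <= (w i * z i)%:E by rewrite lee_fin mulr_ge0.
have S0 : 0 <= S by exact: esum_ge0.
have [Soo|Sfin] := eqVneq S +oo.
  by rewrite Soo mulry gtr0_sg// mul1e leey.
set Z := \esum_(i in _) _.
have Z0 : 0 <= Z by exact: esum_ge0.
have key (l : R) : (0 <= l)%R -> (2 * l)%:E * Z <= (l ^+ 2 * M)%:E + S.
  move=> l0; rewrite -esumZl ?mulr_ge0//.
  apply: (@le_trans _ _ (\esum_(i in [set: I])
     ((l ^+ 2)%:E * (w i)%:E + (w i * z i ^+ 2)%:E))).
    apply: le_esum => i _; rewrite -!EFinM -EFinD lee_fin.
    have := mulr_ge0 (w0 i) (sqr_ge0 (l - z i)); nra.
  rewrite esumD//; last by move=> i _; rewrite mule_ge0 ?lee_fin ?sqr_ge0.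
  rewrite esumZl ?sqr_ge0// leeD2r// (EFinM (l ^+ 2)).
  by apply: lee_wpmul2l; rewrite ?lee_fin ?sqr_ge0.
have Sr : S \is a fin_num by rewrite ge0_fin_numE// ltey.
have Zr : Z \is a fin_num.
  rewrite ge0_fin_numE// ltey; apply/eqP => Zoo.
  have := key 1%R ler01; rewrite Zoo mulr1 mulry gtr0_sg// mul1e.
  by rewrite leye_eq -(fineK Sr).
move: key Z0 S0; rewrite -(fineK Zr) -(fineK Sr).
move: (fine Z) (fine S) => {Zr Sr Sfin}x y key.
rewrite !lee_fin => Z0 S0; rewrite -expr2.
have := key (x / M)%R; rewrite divr_ge0 ?(ltW M0)// => /(_ isT).
rewrite -!EFinM -EFinD lee_fin => H.
have -> : (x ^+ 2 = M * (2 * (x / M) * x - (x / M) ^+ 2 * M))%R.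
  by field; rewrite gt_eqF.
by rewrite ler_pM2l//; lra.
Qed.

(** Schur's test: Cauchy-Schwarz along each row uses the row sums, and the column sums appear after
    exchanging the two summations. *)
Lemma esum_schur (I J : choiceType) (w : I -> J -> R) (z : J -> R) (M N : R) :
  (0 < M)%R -> (0 <= N)%R ->
  (forall i j, 0 <= w i j)%R -> (forall j, 0 <= z j)%R ->
  (forall i, \esum_(j in [set: J]) (w i j)%:E <= M%:E) ->
  (forall j, \esum_(i in [set: I]) (w i j)%:E <= N%:E) ->
  \esum_(i in [set: I]) (\esum_(j in [set: J]) (w i j * z j)%:E) ^+ 2 <=
    (M * N)%:E * \esum_(j in [set: J]) (z j ^+ 2)%:E.
Proof.
move=> M0 N0 w0 z0 wM wN.
have wz0 i j : 0 <= (w i j * z j ^+ 2)%:E.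
  by rewrite lee_fin mulr_ge0// sqr_ge0.
apply: (@le_trans _ _ (\esum_(i in [set: I])
    (M%:E * \esum_(j in [set: J]) (w i j * z j ^+ 2)%:E))).
  by apply: le_esum => i _; exact: esum_jensen.
rewrite esumZl ?(ltW M0)//; last by move=> i; exact: esum_ge0.
rewrite EFinM -muleA; apply: lee_wpmul2l; rewrite ?lee_fin ?(ltW M0)//.
rewrite esum_swap// -esumZl//; last by move=> j; rewrite lee_fin sqr_ge0.
apply: le_esum => j _.
rewrite (eq_esum (b := fun i => (z j ^+ 2)%:E * (w i j)%:E)); last first.
  by move=> i _; rewrite -EFinM mulrC.
rewrite esumZl ?sqr_ge0//; last by move=> i; rewrite lee_fin.
rewrite muleC.
by apply: lee_wpmul2r; rewrite ?lee_fin ?sqr_ge0.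
Qed.

End Esum.

(** * Signed sums of absolutely summable real families *)

Section Rsum.
Variable (R : realType) (V : countType).
Implicit Types (g h p q x y : V -> R) (a : V).

Definition l1 h : Prop := (\esum_(a in [set: V]) `|h a|%:E < +oo)%E.

Lemma l1_le (M : R) g h : (forall a, `|g a| <= M * `|h a|) -> l1 h -> l1 g.
Proof.
move=> gh hl; apply: (@le_lt_trans _ _
   (\esum_(a in [set: V]) ((Num.max M 0)%:E * `|h a|%:E))%E).
  apply: le_esum => a _; rewrite -EFinM lee_fin (le_trans (gh a))//.
  by rewrite ler_wpM2r// le_max lexx.
rewrite esumZl//; last by rewrite le_max lexx orbT.
have h0 : (0 <= \esum_(a in [set: V]) `|h a|%:E)%E by exact: esum_ge0.
by rewrite -(@fineK _ (\esum_(a in [set: V]) `|h a|%:E)%E) ?ge0_fin_numE// -EFinM ltry.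
Qed.

Lemma l1Z (c : R) h : l1 h -> l1 (fun a => c * h a).
Proof. by apply: (@l1_le `|c|) => a; rewrite normrM. Qed.

Lemma l1D g h : l1 g -> l1 h -> l1 (fun a => g a + h a).
Proof.
move=> gl hl; rewrite /l1.
apply: (@le_lt_trans _ _ (\esum_(a in [set: V]) (`|g a|%:E + `|h a|%:E))%E).
  by apply: le_esum => a _; rewrite -EFinD lee_fin ler_normD.
by rewrite esumD//; apply: lte_add_pinfty.
Qed.

Lemma l1_sum (I : Type) (s : seq I) (h : I -> V -> R) :
  (forall i, l1 (h i)) -> l1 (fun a => \sum_(i <- s) h i a).
Proof.
move=> hl; elim: s => [|i s IHs].
  rewrite /l1 (eq_esum (b := fun=> 0%E)) ?esum1// => a _.
  by rewrite big_nil normr0.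
under [X in l1 X]funext do rewrite big_cons.
exact: l1D.
Qed.

Lemma l1_bounded h : l1 h -> exists M, forall a, `|h a| <= M.
Proof.
move=> hl; exists (fine (\esum_(a in [set: V]) `|h a|%:E)) => a.
rewrite -lee_fin fineK; last by rewrite ge0_fin_numE//; exact: esum_ge0.
exact: (@esum_ge_term R V (fun a => `|h a|%:E)).
Qed.

Lemma l1M g h : l1 g -> l1 h -> l1 (fun a => g a * h a).
Proof.
move=> /l1_bounded[M gM]; apply: (@l1_le M) => a.
by rewrite normrM ler_wpM2r.
Qed.

Lemma l1_delta a : l1 (fun v => (v == a)%:R).
Proof.
rewrite /l1 (esumID [set a])// setTI esum_set1//.
rewrite esum1 ?adde0 ?ltry// => v [_ /= va].
by case: eqP => //; rewrite normr0.
Qed.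

(** Frees [rsum] from the positive and negative parts of its definition: these parts are not
    additive in h, but sums of decompositions are decompositions. *)
Lemma rsum_diff p q h : (forall a, h a = p a - q a) ->
  (forall a, 0 <= p a) -> (forall a, 0 <= q a) -> l1 p -> l1 q ->
  rsum h = fine (\esum_(a in [set: V]) (p a)%:E)%E -
           fine (\esum_(a in [set: V]) (q a)%:E)%E.
Proof.
move=> hE p0 q0 pl ql.
have sp : \esum_(a in [set: V]) (p a)%:E \is a fin_num.
  rewrite ge0_fin_numE; last by apply: esum_ge0 => a _; rewrite lee_fin.
  by apply: le_lt_trans pl; apply: le_esum => a _; rewrite lee_fin ler_norm.
have sq : \esum_(a in [set: V]) (q a)%:E \is a fin_num.
  rewrite ge0_fin_numE; last by apply: esum_ge0 => a _; rewrite lee_fin.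
  by apply: le_lt_trans ql; apply: le_esum => a _; rewrite lee_fin ler_norm.
rewrite -fineB// /rsum; congr fine.
rewrite -(@esumB _ _ setT (EFin \o p) (EFin \o q))//.
- congr (_ - _)%E; apply: eq_esum => a _.
    by rewrite hE funeposE /= EFin_max.
  by rewrite hE funenegE /= EFin_max.
- by move=> a _; rewrite lee_fin.
- by move=> a _; rewrite lee_fin.
Qed.

Lemma rsum_ge0E h : (forall a, 0 <= h a) ->
  rsum h = fine (\esum_(a in [set: V]) (h a)%:E)%E.
Proof.
move=> h0; rewrite /rsum [X in (_ - X)%E]esum1 ?sube0.
  by congr fine; apply: eq_esum => a _; rewrite max_l.
by move=> a _; rewrite max_r// oppr_le0.
Qed.

Lemma rsum_ge0 h : (forall a, 0 <= h a) -> 0 <= rsum h.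
Proof.
by move=> h0; rewrite rsum_ge0E// fine_ge0// esum_ge0// => a _; rewrite lee_fin.
Qed.

Lemma rsum0 : rsum (fun _ : V => 0 : R) = 0.
Proof. by rewrite rsum_ge0E// esum1. Qed.

(** The right-hand side is the sum of the positive and the negative total, so it is infinite as soon
    as one of them is; otherwise this is the triangle inequality. *)
Lemma rsum_norm h : (`|rsum h|%:E <= \esum_(a in [set: V]) `|h a|%:E)%E.
Proof.
pose P := \esum_(a in [set: V]) (Num.max (h a) 0)%:E.
pose N := \esum_(a in [set: V]) (Num.max (- h a) 0)%:E.
have m0 (r : R) : (0 <= (Num.max r 0)%:E)%E by rewrite lee_fin le_max lexx orbT.
have P0 : (0 <= P)%E by exact: esum_ge0.
have N0 : (0 <= N)%E by exact: esum_ge0.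
have -> : (\esum_(a in [set: V]) `|h a|%:E = P + N)%E.
  rewrite -esumD//; apply: eq_esum => a _; rewrite -EFinD; congr EFin.
  rewrite /Num.max oppr_lt0.
  case: (ltgtP (h a) 0) => [h0|h0|->]; last by rewrite normr0 oppr0 addr0.
    by rewrite ltr0_norm// add0r.
  by rewrite gtr0_norm// addr0.
rewrite /rsum -/P -/N.
have [Poo|Pfin] := eqVneq P +oo%E; first by rewrite Poo [leRHS]addye ?leey// -ltNye (lt_le_trans _ N0).
have [Noo|Nfin] := eqVneq N +oo%E; first by rewrite Noo [leRHS]addey ?leey// -ltNye (lt_le_trans _ P0).
rewrite -(@fineK _ P) ?ge0_fin_numE ?ltey//.
rewrite -(@fineK _ N) ?ge0_fin_numE ?ltey//.
rewrite -EFinB -EFinD lee_fin /= (le_trans (ler_normB _ _))//.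
by rewrite !ger0_norm ?fine_ge0.
Qed.

Let pos h a := Num.max (h a) 0.
Let neg h a := Num.max (- h a) 0.

Let pos_ge0 h a : 0 <= pos h a. Proof. by rewrite le_max lexx orbT. Qed.
Let neg_ge0 h a : 0 <= neg h a. Proof. by rewrite le_max lexx orbT. Qed.

Let posneg h a : h a = pos h a - neg h a.
Proof.
rewrite /pos /neg /Num.max oppr_lt0.
by case: (ltgtP (h a) 0) => [?|?|->]; rewrite ?subr0 ?sub0r ?opprK ?oppr0 ?addr0.
Qed.

Let l1_pos h : l1 h -> l1 (pos h).
Proof.
apply: (@l1_le 1) => a; rewrite ger0_norm// mul1r /pos /Num.max.
by case: ifP => // _; exact: ler_norm.
Qed.

Let l1_neg h : l1 h -> l1 (neg h).
Proof.
apply: (@l1_le 1) => a; rewrite ger0_norm// mul1r /neg /Num.max.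
by case: ifP => // _; rewrite -normrN ler_norm.
Qed.

Let fin p : l1 p -> (forall a, 0 <= p a) ->
  \esum_(a in [set: V]) (p a)%:E \is a fin_num.
Proof.
move=> pl p0; rewrite ge0_fin_numE; last first.
  by apply: esum_ge0 => a _; rewrite lee_fin.
by apply: le_lt_trans pl; apply: le_esum => a _; rewrite lee_fin ler_norm.
Qed.

Lemma rsumD g h : l1 g -> l1 h ->
  rsum (fun a => g a + h a) = rsum g + rsum h.
Proof.
move=> gl hl.
rewrite (@rsum_diff (fun a => pos g a + pos h a) (fun a => neg g a + neg h a)).
- rewrite (@rsum_diff (pos g) (neg g) g) ?(@rsum_diff (pos h) (neg h) h)//;
    do ?by [exact: l1_pos|exact: l1_neg].
  under eq_esum do rewrite EFinD.
  rewrite esumD//; do ?by move=> *; rewrite lee_fin.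
  under [X in _ - fine X]eq_esum do rewrite EFinD.
  rewrite esumD//; do ?by move=> *; rewrite lee_fin.
  by rewrite !fineD ?fin//; do ?by [exact: l1_pos|exact: l1_neg]; ring.
- by move=> a; rewrite (posneg g a) (posneg h a); ring.
- by move=> a; rewrite addr_ge0.
- by move=> a; rewrite addr_ge0.
- by apply: l1D; exact: l1_pos.
- by apply: l1D; exact: l1_neg.
Qed.

Lemma rsumN h : l1 h -> rsum (fun a => - h a) = - rsum h.
Proof.
move=> hl; rewrite (@rsum_diff (neg h) (pos h) (fun a => - h a))//;
  do ?by [exact: l1_pos|exact: l1_neg].
  by rewrite (@rsum_diff (pos h) (neg h) h) ?opprB//; [exact: l1_pos|exact: l1_neg].
by move=> a; rewrite {1}(posneg h a) opprB.
Qed.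

Lemma rsumZ (c : R) h : l1 h -> rsum (fun a => c * h a) = c * rsum h.
Proof.
move=> hl.
have pos_case d : 0 <= d -> rsum (fun a => d * h a) = d * rsum h.
  move=> d0; rewrite (@rsum_diff (fun a => d * pos h a) (fun a => d * neg h a)).
  - rewrite (@rsum_diff (pos h) (neg h) h)//;
      do ?by [exact: l1_pos|exact: l1_neg].
    under eq_esum do rewrite EFinM.
    rewrite esumZl//; do ?by move=> *; rewrite lee_fin.
    under [X in _ - fine X]eq_esum do rewrite EFinM.
    rewrite esumZl//; do ?by move=> *; rewrite lee_fin.
    by rewrite !fineM ?fin ?mulrBr//; [exact: l1_neg|exact: l1_pos].
  - by move=> a; rewrite {1}(posneg h a) mulrBr.
  - by move=> a; rewrite mulr_ge0.
  - by move=> a; rewrite mulr_ge0.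
  - by apply: l1Z; exact: l1_pos.
  - by apply: l1Z; exact: l1_neg.
have [/pos_case//|c0] := leP 0 c.
rewrite -[c in RHS]opprK mulNr -pos_case ?oppr_ge0 ?ltW// -rsumN; last exact: l1Z.
by congr rsum; apply/funext => a; rewrite mulNr opprK.
Qed.

Lemma rsum_sum (I : Type) (s : seq I) (h : I -> V -> R) :
  (forall i, l1 (h i)) ->
  rsum (fun a => \sum_(i <- s) h i a) = \sum_(i <- s) rsum (h i).
Proof.
move=> hl; elim: s => [|i s IHs].
  by rewrite big_nil -[RHS]rsum0; congr rsum; apply/funext => a; rewrite big_nil.
rewrite big_cons -IHs -rsumD//; last exact: l1_sum.
by congr rsum; apply/funext => a; rewrite big_cons.
Qed.

Lemma rsum_delta a h : rsum (fun v => (v == a)%:R * h v) = h a.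
Proof.
have -> : (fun v => (v == a)%:R * h v) = (fun v => h a * (v == a)%:R).
  by apply/funext => v; case: eqP => [->|_]; rewrite ?mul1r ?mulr1// mul0r mulr0.
rewrite rsumZ; last exact: l1_delta.
rewrite rsum_ge0E// (esumID [set a])// setTI esum_set1//.
rewrite eqxx esum1 ?adde0 ?mulr1// => v [_ /= va].
by case: eqP.
Qed.

End Rsum.

(** Brings Fubini for signed sums down to exchanging two nonnegative double sums. *)
Lemma rsum_rsum (R : realType) (V W : countType) (h : V -> W -> R) :
  (\esum_(a in [set: V]) \esum_(b in [set: W]) `|h a b|%:E < +oo)%E ->
  rsum (fun a => rsum (h a)) =
  fine (\esum_(a in [set: V]) \esum_(b in [set: W])
     (Num.max (h a b) 0)%:E)%E -
  fine (\esum_(a in [set: V]) \esum_(b in [set: W])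
     (Num.max (- h a b) 0)%:E)%E.
Proof.
move=> hl.
have m0 (r : R) : 0 <= Num.max r 0 by rewrite le_max lexx orbT.
have mN (r : R) : Num.max r 0 <= `|r|.
  by rewrite /Num.max; case: ifP => // _; exact: ler_norm.
have rowl a : l1 (h a).
  apply: le_lt_trans hl.
  apply: (@esum_ge_term R V (fun a => \esum_(b in [set: W]) `|h a b|%:E)%E) => i.
  exact: esum_ge0.
have rowm (k : V -> W -> R) : (forall a b, `|k a b| = `|h a b|) ->
    l1 (fun a => fine (\esum_(b in [set: W]) (Num.max (k a b) 0)%:E)%E) /\
    fine (\esum_(a in [set: V])
      (fine (\esum_(b in [set: W]) (Num.max (k a b) 0)%:E))%:E)%E =
    fine (\esum_(a in [set: V]) \esum_(b in [set: W]) (Num.max (k a b) 0)%:E)%E.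
  move=> kh.
  have le a : (\esum_(b in [set: W]) (Num.max (k a b) 0)%:E <=
               \esum_(b in [set: W]) `|h a b|%:E)%E.
    by apply: le_esum => b _; rewrite -kh lee_fin.
  have ge0 a : (0 <= \esum_(b in [set: W]) (Num.max (k a b) 0)%:E)%E.
    by apply: esum_ge0 => b _; rewrite lee_fin.
  have fink a : (\esum_(b in [set: W]) (Num.max (k a b) 0)%:E)%E \is a fin_num.
    by rewrite ge0_fin_numE//; exact: (le_lt_trans (le a) (rowl a)).
  split; last by congr fine; apply: eq_esum => a _; rewrite fineK.
  apply: le_lt_trans hl; apply: le_esum => a _.
  by rewrite ger0_norm ?fine_ge0// fineK.
have [pl pE] := rowm h (fun _ _ => erefl).
have [ql qE] := rowm (fun a b => - h a b) (fun _ _ => normrN _).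
rewrite -pE -qE; apply: rsum_diff => // a; last first.
- by rewrite fine_ge0// esum_ge0// => b _; rewrite lee_fin.
- by rewrite fine_ge0// esum_ge0// => b _; rewrite lee_fin.
apply: rsum_diff => //.
- move=> b; rewrite /Num.max oppr_lt0.
  case: (ltgtP (h a b) 0) => [h0|h0|->]; rewrite ?oppr0 ?addr0//.
  by rewrite sub0r opprK.
- apply: (l1_le (M := 1) _ (rowl a)) => b.
  by rewrite ger0_norm// mul1r.
- apply: (l1_le (M := 1) _ (rowl a)) => b.
  by rewrite ger0_norm// mul1r -normrN.
Qed.

Lemma rsum_swap (R : realType) (V W : countType) (h : V -> W -> R) :
  (\esum_(a in [set: V]) \esum_(b in [set: W]) `|h a b|%:E < +oo)%E ->
  rsum (fun a => rsum (h a)) = rsum (fun b => rsum (fun a => h a b)).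
Proof.
move=> hl; rewrite !rsum_rsum//.
  by rewrite esum_swap 1?[in X in _ - X = _]esum_swap// => *;
    rewrite lee_fin le_max lexx orbT.
by rewrite esum_swap// => *; rewrite lee_fin.
Qed.

(** * The modulus of complex numbers *)

Section ComplexModulus.
Variable R : realType.
Implicit Types (z w : R[i]) (r : R).
Local Open Scope complex_scope.
Local Notation normc := (@Normc.normc R).

Lemma normcE2 z : normc z = Num.sqrt (complex.Re z ^+ 2 + complex.Im z ^+ 2).
Proof. by case: z. Qed.

Lemma normc_ge0 z : 0 <= normc z.
Proof. by rewrite normcE2 sqrtr_ge0. Qed.

Lemma sqr_normc_ReIm z : normc z ^+ 2 = complex.Re z ^+ 2 + complex.Im z ^+ 2.
Proof. by rewrite normcE2 sqr_sqrtr// addr_ge0 ?sqr_ge0. Qed.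

Lemma normcR r : normc r%:C = `|r|.
Proof. by rewrite /= expr0n addr0 sqrtr_sqr. Qed.

Lemma normc_le_ReIm z : normc z <= `|complex.Re z| + `|complex.Im z|.
Proof.
rewrite -(ler_pXn2r (ltn0Sn 1)) ?nnegrE ?normc_ge0 ?addr_ge0//.
rewrite sqr_normc_ReIm sqrrD !real_normK ?num_real//.
by rewrite -addrA lerD2l lerDr mulrn_wge0// mulr_ge0.
Qed.

Lemma Re_le_normc z : `|complex.Re z| <= normc z.
Proof.
rewrite -(ler_pXn2r (ltn0Sn 1)) ?nnegrE ?normc_ge0//.
by rewrite sqr_normc_ReIm real_normK ?num_real// lerDl sqr_ge0.
Qed.

Lemma Im_le_normc z : `|complex.Im z| <= normc z.
Proof.
rewrite -(ler_pXn2r (ltn0Sn 1)) ?nnegrE ?normc_ge0//.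
by rewrite sqr_normc_ReIm real_normK ?num_real// lerDr sqr_ge0.
Qed.

Lemma normcX z n : normc (z ^+ n) = normc z ^+ n.
Proof.
by elim: n => [|n IHn]; rewrite ?Normc.normc1// !exprS Normc.normcM IHn.
Qed.

Lemma normc_conj z : normc (conjc z) = normc z.
Proof. by case: z => x y /=; rewrite sqrrN. Qed.

Lemma normc_sum (I : Type) (s : seq I) (P : pred I) (F : I -> R[i]) :
  normc (\sum_(i <- s | P i) F i) <= \sum_(i <- s | P i) normc (F i).
Proof.
elim/big_rec2: _ => [|i x y _ xy]; first by rewrite Normc.normc0.
by apply: (le_trans (le_normcD _ _)); rewrite lerD2l.
Qed.

Lemma Re_sum (I : Type) (s : seq I) (F : I -> R[i]) :
  complex.Re (\sum_(i <- s) F i) = \sum_(i <- s) complex.Re (F i).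
Proof. exact: (raddf_sum (@complex.Re R : {additive Rcomplex R -> R})). Qed.

Lemma Im_sum (I : Type) (s : seq I) (F : I -> R[i]) :
  complex.Im (\sum_(i <- s) F i) = \sum_(i <- s) complex.Im (F i).
Proof. exact: (raddf_sum (@complex.Im R : {additive Rcomplex R -> R})). Qed.

End ComplexModulus.

(** * Complex sums and the l2 norm *)

Section Csum.
Variables (R : realType) (V : countType).
Local Open Scope complex_scope.
Local Notation normc := (@Normc.normc R).

(** The factor 2 comes from bounding real and imaginary parts separately; it only enlarges operator
    bounds and is absorbed in the choice of epsilon. *)
Lemma normc_csum (h : V -> R[i]) :
  ((normc (csum h))%:E <= 2%:E * \esum_(a in [set: V]) (normc (h a))%:E)%E.
Proof.
apply: (@le_trans _ _ (`|rsum (fun a => complex.Re (h a))|%:E +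
                       `|rsum (fun a => complex.Im (h a))|%:E)%E).
  by rewrite -EFinD lee_fin normc_le_ReIm.
have -> : (2%:E = 1%:E + 1%:E :> \bar R)%E by rewrite -EFinD.
rewrite ge0_muleDl// !mul1e; apply: leeD; apply: (le_trans (rsum_norm _));
  by apply: le_esum => a _; rewrite lee_fin ?Re_le_normc ?Im_le_normc.
Qed.

Definition sqnorm (x : V -> R[i]) : \bar R :=
  \esum_(a in [set: V]) (normc (x a) ^+ 2)%:E.

Lemma sqnorm_ge0 (x : V -> R[i]) : (0 <= sqnorm x)%E.
Proof. by apply: esum_ge0 => a _; rewrite lee_fin sqr_ge0. Qed.

Lemma l2norm_le (e : R) (x y : V -> R[i]) : 0 <= e ->
  (sqnorm x <= (e ^+ 2)%:E * sqnorm y)%E -> (l2norm x <= e%:E * l2norm y)%E.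
Proof.
move=> e0 xy; rewrite /l2norm -/(sqnorm x) -/(sqnorm y).
have -> : e%:E = ((e ^+ 2)%:E `^ 2^-1)%E.
  by rewrite poweR_EFin powR12_sqrt ?sqr_ge0// sqrtr_sqr ger0_norm.
rewrite -poweRM ?lee_fin ?sqr_ge0 ?sqnorm_ge0//.
apply: gt0_ler_poweR; rewrite ?invr_ge0 ?in_itv//= ?leey ?andbT ?sqnorm_ge0//.
by rewrite mule_ge0 ?lee_fin ?sqr_ge0 ?sqnorm_ge0.
Qed.

Lemma l2_sqnorm (x : V -> R[i]) : l2 x -> (sqnorm x < +oo)%E.
Proof. by apply: lty_poweRy; rewrite invr_eq0. Qed.

Lemma normc_le_l2norm (x : V -> R[i]) a : ((normc (x a))%:E <= l2norm x)%E.
Proof.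
have -> : (normc (x a))%:E = ((normc (x a) ^+ 2)%:E `^ 2^-1)%E.
  by rewrite poweR_EFin powR12_sqrt ?sqr_ge0// sqrtr_sqr ger0_norm ?normc_ge0.
apply: gt0_ler_poweR; rewrite ?invr_ge0//= ?in_itv/= ?andbT ?leey ?sqnorm_ge0 ?lee_fin ?sqr_ge0//.
apply: (@esum_ge_term R V (fun a => (normc (x a) ^+ 2)%:E)) => b.
by rewrite lee_fin sqr_ge0.
Qed.

End Csum.

(** * Tails of the exponential series *)

Lemma exp_coeff_tail (R : realType) (z e : R) : 0 <= z -> 0 < e ->
  \forall n \near \oo, forall N, \sum_(n <= k < N) z ^+ k / k`!%:R <= e.
Proof.
move=> z0 e0; have cv : series (exp_coeff z) @ \oo --> limn (series (exp_coeff z)).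
  exact: is_cvg_series_exp_coeff.
move/cvgrPdist_le/(_ e e0) : cv.
apply: filterS => n nE N.
have [Nn|nN] := leqP N n; first by rewrite big_geq// ltW.
have -> : \sum_(n <= k < N) z ^+ k / k`!%:R =
    series (exp_coeff z) N - series (exp_coeff z) n.
  rewrite /series /= (@big_cat_nat _ _ _ n 0 N)//= ?(ltnW nN)//.
  by rewrite addrC addrK.
apply: le_trans (le_trans (ler_norm _) nE).
rewrite lerD2r; apply: nondecreasing_cvgn_le; last exact: is_cvg_series_exp_coeff.
by apply: nondecreasing_series => k _ _; exact: exp_coeff_ge0.
Qed.

(** The indicator keeps the tail a sum over all of [nat], the form in which it serves as weight in
    [esum_jensen]. *)
Lemma esum_exp_coeff_tail (R : realType) (z e : R) : 0 <= z -> 0 < e ->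
  \forall n \near \oo,
    (\esum_(k in [set: nat]) (z ^+ k / k`!%:R * (n <= k)%:R)%:E <= e%:E)%E.
Proof.
move=> z0 e0; apply: filterS (exp_coeff_tail z0 e0) => n ne.
have t0 k : (0 <= (z ^+ k / k`!%:R * (n <= k)%N%:R)%:E)%E.
  by rewrite lee_fin mulr_ge0// divr_ge0// exprn_ge0.
rewrite -nneseries_esumT//; apply: lime_le; first exact: is_cvg_nneseries.
apply: nearW => N; rewrite sumEFin lee_fin.
have [Nn|nN] := leqP N n.
  rewrite big_nat big1 ?ltW// => k /= kN.
  by rewrite leqNgt (leq_trans kN)//= mulr0.
rewrite (@big_cat_nat _ _ _ n 0 N)//= ?(ltnW nN)// big_nat big1 ?add0r.
  rewrite big_nat; apply: le_trans (ne N); rewrite [leRHS]big_nat.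
  by apply: ler_sum => k /andP[-> _]; rewrite mulr1.
by move=> k /= kn; rewrite leqNgt kn mulr0.
Qed.


(** The finite part is itself an [rsum] of point masses, so the splitting is additivity. *)
Lemma rsum_tail (R : realType) (h : nat -> R) n : l1 h ->
  rsum h = \sum_(k < n) h k + rsum (fun k => if (n <= k)%N then h k else 0).
Proof.
move=> hl.
have dl j : l1 (fun k : nat => (k == j)%:R * h k).
  apply: (l1_le (M := 1) _ hl) => k; rewrite mul1r normrM.
  by case: eqP => _; rewrite ?normr1 ?mul1r// normr0 mul0r.
have tl : l1 (fun k => if (n <= k)%N then h k else 0).
  by apply: (l1_le (M := 1) _ hl) => k; case: ifP; rewrite mul1r ?normr0.
have -> : \sum_(k < n) h k =
    rsum (fun k : nat => \sum_(j <- iota 0 n) (k == j)%:R * h k).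
  rewrite rsum_sum// -(big_mkord xpredT h) /index_iota subn0.
  by apply: eq_bigr => j _; rewrite rsum_delta.
rewrite -rsumD//; last exact: l1_sum.
congr rsum; apply/funext => k; rewrite -mulr_suml.
have -> : \sum_(j <- iota 0 n) (k == j)%:R = (k < n)%:R :> R.
  have [kn|nk] := ltnP k n.
    rewrite (bigD1_seq k) ?mem_iota ?iota_uniq//= eqxx big1 ?addr0// => j.
    by rewrite eq_sym => /negPf->.
  rewrite big_seq big1// => j; rewrite mem_iota add0n => /andP[_ jn].
  by rewrite gtn_eqF// (leq_trans jn).
by case: leqP => _; rewrite ?mul1r ?addr0// mul0r add0r.
Qed.

(** * The exponential of a bounded operator on l2 *)

Section OpExp.
Variables (R : realType) (V : countType).
Local Open Scope complex_scope.
Local Notation normc := (@Normc.normc R).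
Variables (B : (V -> R[i]) -> V -> R[i]) (K : R).
Hypothesis K0 : 0 < K.
Hypothesis B_bounded : forall x, (sqnorm (B x) <= (K ^+ 2)%:E * sqnorm x)%E.

Lemma sqnorm_iter k x :
  (sqnorm (iter k B x) <= ((K ^+ k) ^+ 2)%:E * sqnorm x)%E.
Proof.
elim: k => [|k IHk]; first by rewrite expr0 expr1n mul1e.
rewrite iterS (le_trans (B_bounded _))// (exprS K k) exprMn (EFinM (K ^+ 2)) -muleA.
by apply: lee_wpmul2l => //; rewrite lee_fin sqr_ge0.
Qed.

Let term x a k := (k`!%:R)^-1 * iter k B x a.

(** Separates a weight that is summable in k from a factor whose l2 norm in a is at most that of x,
    whatever k is ([scaled_term_le]). *)
Lemma normc_term x a k :
  normc (term x a k) = K ^+ k / k`!%:R * (normc (iter k B x a) / K ^+ k).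
Proof.
rewrite /term Normc.normcM Normc.normcV.
have -> : normc k`!%:R = k`!%:R.
  by rewrite -(rmorph_nat (real_complex R)) normcR normr_nat.
by field; rewrite expf_neq0 ?gt_eqF//= pnatr_eq0 -lt0n fact_gt0.
Qed.

Lemma scaled_term_le x k : (\esum_(a in [set: V])
  ((normc (iter k B x a) / K ^+ k) ^+ 2)%:E <= sqnorm x)%E.
Proof.
under eq_esum do rewrite exprMn mulrC EFinM.
rewrite esumZl ?sqr_ge0//; last by move=> a; rewrite lee_fin sqr_ge0.
have kK : (0 <= ((K ^+ k)^-1 ^+ 2)%:E)%E by rewrite lee_fin sqr_ge0.
apply: le_trans (lee_wpmul2l kK (sqnorm_iter k x)) _.
rewrite muleA -EFinM -exprMn mulVf ?expr1n ?mul1e//.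
by rewrite expf_neq0// gt_eqF.
Qed.

Lemma esum_exp_coeff (z : R) : 0 <= z ->
  (\esum_(k in [set: nat]) (z ^+ k / k`!%:R)%:E < +oo)%E.
Proof.
move=> z0; have t0 k : (0 <= (z ^+ k / k`!%:R)%:E)%E.
  by rewrite lee_fin divr_ge0// exprn_ge0.
apply: (@le_lt_trans _ _ (expR z)%:E); last exact: ltry.
rewrite -nneseries_esumT//; apply: lime_le; first exact: is_cvg_nneseries.
apply: nearW => N; rewrite sumEFin lee_fin.
apply: (@nondecreasing_cvgn_le R (series (exp_coeff z))).
  by apply: nondecreasing_series => k _ _; exact: exp_coeff_ge0.
exact: is_cvg_series_exp_coeff.
Qed.

Lemma summable_term x a : l2 x -> l1 (fun k => normc (term x a k)).
Proof.
move=> /l2_sqnorm xl.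
have xf : sqnorm x \is a fin_num by rewrite ge0_fin_numE ?sqnorm_ge0.
apply: (@l1_le _ _ (Num.sqrt (fine (sqnorm x))) _ (fun k => K ^+ k / k`!%:R)).
  move=> k; have k0 : 0 <= K ^+ k / k`!%:R by rewrite divr_ge0// exprn_ge0// ltW.
  rewrite ger0_norm ?normc_ge0// normc_term (ger0_norm k0) mulrC ler_wpM2r//.
  have s0 : 0 <= normc (iter k B x a) / K ^+ k.
    by rewrite divr_ge0 ?normc_ge0// exprn_ge0// ltW.
  rewrite -[leLHS](ger0_norm s0) -sqrtr_sqr ler_wsqrtr// -lee_fin fineK//.
  apply: le_trans (scaled_term_le x k).
  apply: (@esum_ge_term R V
    (fun a => ((normc (iter k B x a) / K ^+ k) ^+ 2)%:E)) => b.
  by rewrite lee_fin sqr_ge0.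
rewrite /l1 (eq_esum (b := fun k => (K ^+ k / k`!%:R)%:E)).
  exact/esum_exp_coeff/ltW.
by move=> k _; rewrite ger0_norm// divr_ge0// exprn_ge0// ltW.
Qed.

Lemma exp_partial_tail n x a : l2 x ->
  exp_partial B n x a - csum (term x a) =
  - csum (fun k => if (n <= k)%N then term x a k else 0).
Proof.
move=> /(summable_term a) tl; apply/eqP; rewrite -[X in _ == X]add0r -subr_eq0.
have Rl : l1 (fun k => complex.Re (term x a k)).
  apply: (l1_le (M := 1) _ tl) => k.
  by rewrite mul1r (ger0_norm (normc_ge0 _)) Re_le_normc.
have Il : l1 (fun k => complex.Im (term x a k)).
  apply: (l1_le (M := 1) _ tl) => k.
  by rewrite mul1r (ger0_norm (normc_ge0 _)) Im_le_normc.
have -> : csum (term x a) = exp_partial B n x a +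
    csum (fun k => if (n <= k)%N then term x a k else 0).
  rewrite /csum (rsum_tail n Rl) (rsum_tail n Il) /exp_partial.
  apply/eqP; rewrite eq_complex /= !raddfD /= Re_sum Im_sum /=.
  apply/andP; split; apply/eqP; congr (_ + rsum _); apply/funext => k.
  - by case: ifP.
  - by case: ifP.
by rewrite opprD addrA subrr add0r subrr.
Qed.

(** At each vertex the tail is estimated by [esum_jensen] in k, with the weights [r]; summing over
    the vertices and exchanging sums leaves the total weight times the squared norm of x. *)
Lemma op_cvg_exp_partial :
  op_cvg (exp_partial B) (fun x a => csum (term x a)).
Proof.
(* The total weight enters twice, and [normc_csum] costs 2 before squaring: 4 (e / 2)^2 = e^2. *)
move=> e e0; have e20 : 0 < e / 2 by rewrite divr_gt0.
apply: filterS (esum_exp_coeff_tail (ltW K0) e20) => n ne x xl.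
apply: l2norm_le; first exact: ltW.
pose r k := K ^+ k / k`!%:R * (n <= k)%N%:R.
pose z a k := normc (iter k B x a) / K ^+ k.
have r0 k : 0 <= r k.
  by rewrite mulr_ge0// divr_ge0// exprn_ge0// ltW.
have z0 a k : 0 <= z a k.
  by rewrite divr_ge0 ?normc_ge0// exprn_ge0// ltW.
have rz0 a k : (0 <= (r k * z a k ^+ 2)%:E)%E by rewrite lee_fin mulr_ge0 ?sqr_ge0.
have diff_le a :
    ((normc (exp_partial B n x a - csum (term x a))%R ^+ 2)%:E <=
     4%:E * ((e / 2)%:E * \esum_(k in [set: nat]) (r k * z a k ^+ 2)%:E))%E.
  have le1 : ((normc (exp_partial B n x a - csum (term x a)))%:E <=
              2%:E * \esum_(k in [set: nat]) (r k * z a k)%:E)%E.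
    rewrite exp_partial_tail// normcN (le_trans (normc_csum _))//.
    apply: lee_wpmul2l => //; apply: le_esum => k _; rewrite lee_fin.
    case: leqP => nk; last by rewrite Normc.normc0 mulr_ge0.
    by rewrite normc_term /r nk mulr1.
  have jen := esum_jensen e20 r0 (z0 a) ne.
  have -> : (4%:E = 2%:E * 2%:E :> \bar R)%E by rewrite -EFinM -natrM.
  have n0 : (0 <= (normc (exp_partial B n x a - csum (term x a))%R)%:E)%E.
    by rewrite lee_fin normc_ge0.
  rewrite EFin_expe expe2; apply: le_trans (lee_pmul n0 n0 le1 le1) _.
  rewrite muleACA; apply: lee_wpmul2l => //.
apply: (@le_trans _ _ (\esum_(a in [set: V])
    (4%:E * ((e / 2)%:E * \esum_(k in [set: nat]) (r k * z a k ^+ 2)%:E)))%E).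
  exact: le_esum.
have e2ge0 : (0 <= (e / 2)%:E)%E by rewrite lee_fin ltW.
rewrite esumZl//; last by move=> a; rewrite mule_ge0// esum_ge0.
rewrite esumZl ?(ltW e20)//; last by move=> a; rewrite esum_ge0.
rewrite esum_swap//.
apply: (@le_trans _ _ (4%:E * ((e / 2)%:E * \esum_(k in [set: nat])
    (sqnorm x * (r k)%:E)))%E).
  apply: lee_wpmul2l => //; apply: lee_wpmul2l => //.
  apply: le_esum => k _.
  under eq_esum do rewrite EFinM.
  rewrite esumZl//; last by move=> a; rewrite lee_fin sqr_ge0.
  by rewrite muleC; apply: lee_wpmul2r; [rewrite lee_fin|exact: scaled_term_le].
have xf : sqnorm x \is a fin_num by rewrite ge0_fin_numE ?sqnorm_ge0 ?l2_sqnorm.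
have xx : (sqnorm x = (fine (sqnorm x))%:E)%E by rewrite fineK.
rewrite xx esumZl ?fine_ge0 ?sqnorm_ge0//.
apply: (@le_trans _ _ (4%:E * ((e / 2)%:E * ((fine (sqnorm x))%:E * (e / 2)%:E)))%E).
  apply: lee_wpmul2l => //; apply: lee_wpmul2l => //.
  by apply: lee_wpmul2l => //; rewrite lee_fin fine_ge0 ?sqnorm_ge0.
rewrite -!EFinM lee_fin le_eqVlt; apply/orP; left; apply/eqP.
by field.
Qed.

(** Whatever limit [xget] selects, it is a limit in operator norm because one exists; each
    coordinate is bounded by the l2 norm. *)
Lemma op_exp_cvg x a : l2 x -> forall e : R, 0 < e ->
  \forall n \near \oo, normc (exp_partial B n x a - op_exp B x a) <= e.
Proof.
move=> xl e e0.
have cvg : op_cvg (exp_partial B) (op_exp B).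
  apply: (@xgetPex _ _ [set E | op_cvg (exp_partial B) E]).
  by exists (fun x a => csum (term x a)); exact: op_cvg_exp_partial.
have x0 : (0 <= l2norm x)%E by exact: poweR_ge0.
pose N := fine (l2norm x).
have N0 : 0 <= N by exact: fine_ge0.
(* [N + 1] in place of [N] keeps the denominator positive when x vanishes. *)
have d0 : 0 < e / (N + 1) by rewrite divr_gt0// ltr_wpDl.
apply: filterS (cvg _ d0) => n /(_ x xl) nle.
rewrite -lee_fin.
apply: le_trans (normc_le_l2norm (fun a => exp_partial B n x a - op_exp B x a) a) _.
apply: (le_trans nle); rewrite -(@fineK _ (l2norm x)) ?ge0_fin_numE//.
rewrite -EFinM lee_fin -/N mulrAC ler_pdivrMr ?ltr_wpDl//.
by rewrite ler_wpM2l ?ltW// ltrDl.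
Qed.

End OpExp.

(** * The adjacency operator on real l1 vectors and its moments *)

Section Adjacency.
Variables (R : realType) (V : countType).
Implicit Types (x y z : V -> R) (a b : V).

Definition dot x y : R := rsum (fun a => x a * y a).

Lemma dotC x y : dot x y = dot y x.
Proof. by congr rsum; apply/funext => a; rewrite mulrC. Qed.

Lemma dotDr x y z : l1 x -> l1 y -> l1 z ->
  dot x (fun a => y a + z a) = dot x y + dot x z.
Proof.
move=> xl yl zl; rewrite /dot -rsumD; [|exact: l1M|exact: l1M].
by congr rsum; apply/funext => a; rewrite mulrDr.
Qed.

Lemma dotZr c x y : l1 x -> l1 y -> dot x (fun a => c * y a) = c * dot x y.
Proof.
move=> xl yl; rewrite /dot -rsumZ; last exact: l1M.
by congr rsum; apply/funext => a; rewrite mulrCA.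
Qed.

Lemma dot_sumr (I : Type) (s : seq I) x (y : I -> V -> R) :
  l1 x -> (forall i, l1 (y i)) ->
  dot x (fun a => \sum_(i <- s) y i a) = \sum_(i <- s) dot x (y i).
Proof.
move=> xl yl; rewrite /dot -rsum_sum; last by move=> i; exact: l1M.
by congr rsum; apply/funext => a; rewrite mulr_sumr.
Qed.

Lemma dot_ge0 x : 0 <= dot x x.
Proof. by apply: rsum_ge0 => a; rewrite -expr2 sqr_ge0. Qed.

Lemma dot_delta a x : dot (fun v => (v == a)%:R) x = x a.
Proof. exact: rsum_delta. Qed.

Lemma cauchy_schwarz x y : l1 x -> l1 y ->
  dot x y ^+ 2 <= dot x x * dot y y.
Proof.
move=> xl yl.
have key (l : R) : 0 <= dot y y - 2 * l * dot x y + l ^+ 2 * dot x x.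
  have xlZ := l1Z (- l) xl.
  have := dot_ge0 (fun a => y a + - l * x a).
  rewrite dotDr ?dotZr//; try exact: l1D.
  rewrite ![dot (fun a => _ + _) _]dotC !dotDr ?dotZr// (dotC y x).
  by move=> /le_trans; apply; rewrite le_eqVlt; apply/orP; left; apply/eqP; ring.
have [xx0|xxn0] := eqVneq (dot x x) 0.
  have [->|xyn0] := eqVneq (dot x y) 0; first by rewrite expr0n xx0 mul0r.
  (* Here the quadratic in l is affine, and this l gives it the value -1. *)
  have := key ((dot y y + 1) / (2 * dot x y)).
  rewrite xx0 mulr0 addr0.
  have -> : 2 * ((dot y y + 1) / (2 * dot x y)) * dot x y = dot y y + 1.
    by field.
  by rewrite opprD addrA subrr sub0r oppr_ge0 ler10.
have xx : 0 < dot x x by rewrite lt_neqAle eq_sym xxn0 dot_ge0.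
have := key (dot x y / dot x x).
have -> : dot y y - 2 * (dot x y / dot x x) * dot x y +
    (dot x y / dot x x) ^+ 2 * dot x x = (dot x x * dot y y - dot x y ^+ 2) / dot x x.
  by field.
by rewrite pmulr_lge0 ?invr_gt0// subr_ge0.
Qed.

Variables (G : graph R V) (M : R).
Hypothesis M0 : 0 < M.
Hypothesis GM : forall a, (\esum_(b in [set: V]) `|G a b|%:E <= M%:E)%E.

(** The real counterpart of [adj_op]; powers of it are factored out of the iterates of the generator
    in [iter_evolution_generator]. *)
Definition adjacency x a : R := rsum (fun b => G a b * x b).

Lemma l1_row a : l1 (G a).
Proof. exact: le_lt_trans (GM a) (ltry _). Qed.

Lemma col_bound b : (\esum_(a in [set: V]) `|G a b|%:E <= M%:E)%E.
Proof. by under eq_esum do rewrite wt_sym. Qed.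

(** Columns are bounded like rows by symmetry. Besides stability of l1, this supplies the absolute
    summability behind the exchange of sums in [dot_adjacency]. *)
Lemma esum_esum_adjacency x : (\esum_(a in [set: V]) \esum_(b in [set: V])
  `|G a b * x b|%:E <= M%:E * \esum_(b in [set: V]) `|x b|%:E)%E.
Proof.
rewrite esum_swap// -esumZl ?(ltW M0)//.
apply: le_esum => b _.
under eq_esum do rewrite normrM mulrC EFinM.
rewrite esumZl// muleC.
by apply: lee_wpmul2r => //; exact: col_bound.
Qed.

Lemma esum_adjacency x : (\esum_(a in [set: V]) `|adjacency x a|%:E <=
  M%:E * \esum_(a in [set: V]) `|x a|%:E)%E.
Proof.
apply: le_trans (esum_esum_adjacency x); apply: le_esum => a _.
exact: rsum_norm.
Qed.

Lemma l1_adjacency x : l1 x -> l1 (adjacency x).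
Proof.
move=> xl; apply: (le_lt_trans (esum_adjacency x)).
rewrite -(@fineK _ (\esum_(a in [set: V]) `|x a|%:E)%E).
  by rewrite -EFinM ltry.
by rewrite ge0_fin_numE//; exact: esum_ge0.
Qed.

Lemma l1_iter_adjacency k x : l1 x -> l1 (iter k adjacency x).
Proof. by move=> xl; elim: k => // k IHk; rewrite iterS; exact: l1_adjacency. Qed.

Lemma l1_adjacency_term x a : l1 x -> l1 (fun b => G a b * x b).
Proof. by apply: l1M; exact: l1_row. Qed.

Lemma adjacencyD x y : l1 x -> l1 y ->
  adjacency (fun a => x a + y a) = (fun a => adjacency x a + adjacency y a).
Proof.
move=> xl yl; apply/funext => a; rewrite /adjacency -rsumD; try exact: l1_adjacency_term.
by congr rsum; apply/funext => b; rewrite mulrDr.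
Qed.

Lemma adjacencyZ c x : l1 x -> adjacency (fun a => c * x a) = (fun a => c * adjacency x a).
Proof.
move=> xl; apply/funext => a; rewrite /adjacency -rsumZ; try exact: l1_adjacency_term.
by congr rsum; apply/funext => b; rewrite mulrCA.
Qed.

Lemma adjacency_delta b a : adjacency (fun v => (v == b)%:R) a = G a b.
Proof.
by rewrite -[RHS](rsum_delta b (G a)); congr rsum; apply/funext => v; rewrite mulrC.
Qed.

Lemma dot_adjacency x y : l1 x -> l1 y -> dot (adjacency x) y = dot x (adjacency y).
Proof.
move=> xl yl.
transitivity (rsum (fun a => rsum (fun b => y a * (G a b * x b)))).
  congr rsum; apply/funext => a; rewrite rsumZ; last exact: l1_adjacency_term.
  by rewrite mulrC.
rewrite rsum_swap; last first.
  have [N yN] := l1_bounded yl.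
  have N0 : 0 <= Num.max N 0 by rewrite le_max lexx orbT.
  apply: (@le_lt_trans _ _ ((Num.max N 0)%:E *
     \esum_(a in [set: V]) \esum_(b in [set: V]) `|G a b * x b|%:E)%E).
    rewrite -esumZl//; last by move=> a; exact: esum_ge0.
    apply: le_esum => a _; rewrite -esumZl//; apply: le_esum => b _.
    rewrite -EFinM lee_fin normrM ler_wpM2r// (le_trans (yN a))//.
    by rewrite le_max lexx.
  apply: (@le_lt_trans _ _ ((Num.max N 0)%:E *
     (M%:E * \esum_(a in [set: V]) `|x a|%:E))%E).
    by apply: lee_wpmul2l; rewrite ?lee_fin//; exact: esum_esum_adjacency.
  rewrite -(@fineK _ (\esum_(a in [set: V]) `|x a|%:E)%E).
    by rewrite -!EFinM ltry.
  by rewrite ge0_fin_numE//; exact: esum_ge0.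
congr rsum; apply/funext => b; rewrite -rsumZ; last exact: l1_adjacency_term.
by congr rsum; apply/funext => a; rewrite (wt_sym G a b); ring.
Qed.

(** Makes the Gram matrix of the iterates of x a Hankel matrix of moments, the shape assumed by
    [iexp_gram]. *)
Lemma dot_iter_adjacency j k x y : l1 x -> l1 y ->
  dot (iter j adjacency x) (iter k adjacency y) = dot x (iter (j + k) adjacency y).
Proof.
move=> xl yl; elim: j k => [|j IHj] k //.
rewrite iterS dot_adjacency; [|exact: l1_iter_adjacency..].
by rewrite -iterS IHj addnS.
Qed.

Lemma esum_iter_adjacency k x : (\esum_(a in [set: V]) `|iter k adjacency x a|%:E <=
  (M ^+ k)%:E * \esum_(a in [set: V]) `|x a|%:E)%E.
Proof.
elim: k => [|k IHk]; first by rewrite expr0 mul1e.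
rewrite iterS (le_trans (esum_adjacency _))// exprS EFinM -muleA.
by apply: lee_wpmul2l => //; rewrite lee_fin ltW.
Qed.

(** The sup norm of x is paired with the l1 norm of the iterate, which grows at most geometrically;
    the factorials of the exponential series absorb this growth. *)
Lemma moment_bound x y : l1 x -> l1 y ->
  exists2 N : R, 0 <= N & forall k, `|dot x (iter k adjacency y)| <= N * M ^+ k.
Proof.
move=> xl yl; have [N xN] := l1_bounded xl.
have N0 : 0 <= Num.max N 0 by rewrite le_max lexx orbT.
have yf : \esum_(a in [set: V]) `|y a|%:E \is a fin_num.
  by rewrite ge0_fin_numE//; exact: esum_ge0.
exists (Num.max N 0 * fine (\esum_(a in [set: V]) `|y a|%:E)%E).
  by rewrite mulr_ge0// fine_ge0// esum_ge0.
move=> k; rewrite -lee_fin (le_trans (rsum_norm _))//.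
apply: (@le_trans _ _ ((Num.max N 0)%:E *
   \esum_(a in [set: V]) `|iter k adjacency y a|%:E)%E).
  rewrite -esumZl//; apply: le_esum => a _.
  by rewrite -EFinM lee_fin normrM ler_wpM2r// (le_trans (xN a))// le_max lexx.
rewrite mulrAC EFinM fineK// EFinM -muleA.
by apply: lee_wpmul2l; rewrite ?lee_fin//; exact: esum_iter_adjacency.
Qed.

End Adjacency.

(** * The generator of the evolution *)

Section Evolution.
Variables (R : realType) (V : countType) (G : graph R V) (M : R).
Hypothesis M0 : 0 < M.
Hypothesis GM : forall a, (\esum_(b in [set: V]) `|G a b|%:E <= M%:E)%E.
Local Open Scope complex_scope.
Local Notation normc := (@Normc.normc R).
Variable t : R.

Let B (x : V -> R[i]) a := (0 +i* t) * adj_op G x a.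
(** The 2 is that of [normc_csum], and [|t| + 1] keeps the constant positive at t = 0. *)
Let K := 2 * (`|t| + 1) * M.

(** Schur's test for the moduli of the weights, whose row and column sums agree by symmetry. *)
Lemma sqnorm_evolution_generator x :
  (sqnorm (B x) <= (K ^+ 2)%:E * sqnorm x)%E.
Proof.
have t0 : 0 < `|t| + 1 by rewrite ltr_wpDl.
have K0 : 0 < K by rewrite !mulr_gt0.
pose w a b := 2 * (`|t| + 1) * `|G a b|.
have w0 a b : 0 <= w a b by rewrite !mulr_ge0// addr_ge0.
have wK a : (\esum_(b in [set: V]) (w a b)%:E <= K%:E)%E.
  under eq_esum do rewrite EFinM.
  rewrite esumZl//.
  by rewrite [leRHS]EFinM; apply: lee_wpmul2l => //; rewrite lee_fin mulr_ge0// addr_ge0.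
have wK' b : (\esum_(a in [set: V]) (w a b)%:E <= K%:E)%E.
  by under eq_esum do rewrite /w wt_sym; exact: wK.
have := esum_schur K0 (ltW K0) w0 (fun b => normc_ge0 (x b)) wK wK'.
apply: le_trans; apply: le_esum => a _.
have n0 : (0 <= (normc (B x a))%:E)%E by rewrite lee_fin normc_ge0.
have le : ((normc (B x a))%:E <=
    \esum_(b in [set: V]) (w a b * normc (x b))%:E)%E.
  rewrite /B Normc.normcM EFinM.
  have -> : normc (0 +i* t) = `|t| by rewrite /= expr0n add0r sqrtr_sqr.
  have tE : (0 <= `|t|%:E)%E by rewrite lee_fin.
  apply: le_trans (lee_wpmul2l tE (normc_csum _)) _.
  rewrite muleA -EFinM -esumZl ?mulr_ge0//; last first.
    by move=> b; rewrite lee_fin normc_ge0.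
  apply: le_esum => b _; rewrite -EFinM lee_fin Normc.normcM normcR /w.
  rewrite mulrA ler_wpM2r ?normc_ge0// ler_wpM2r// mulrC ler_wpM2l//.
  by rewrite lerDl.
by rewrite EFin_expe !expe2; exact: lee_pmul.
Qed.

Lemma iter_evolution_generator k (x : V -> R) : l1 x ->
  iter k B (fun a => (x a)%:C) =
  (fun a => (0 +i* t) ^+ k * (iter k (adjacency G) x a)%:C).
Proof.
move=> xl; elim: k => [|k IHk]; first by apply/funext => a; rewrite mul1r.
rewrite !iterS IHk; apply/funext => a; rewrite /B /adj_op exprS -mulrA.
congr (_ * _).
have yl : l1 (fun b => G a b * iter k (adjacency G) x b).
  exact/(l1_adjacency_term GM)/(l1_iter_adjacency M0 GM).
(* [csum] is computed on real and imaginary parts, so the complex scalar is pulled out through its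
   two components. *)
move: ((0 +i* t) ^+ k) => -[c d].
rewrite /adjacency; apply/eqP; rewrite eq_complex /=; apply/andP; split; apply/eqP.
- rewrite mulr0 subr0 -rsumZ//; congr rsum; apply/funext => b.
  by rewrite !(mul0r, mulr0, subr0, addr0, add0r) mulrCA.
- rewrite mulr0 add0r -rsumZ//; congr rsum; apply/funext => b.
  by rewrite !(mul0r, mulr0, subr0, addr0, add0r) mulrCA.
Qed.

End Evolution.

(** * The identity exp(itz) exp(-itz) = 1 for truncated series *)

Lemma exp_coeff_binomial (F : numFieldType) (x y : F) n :
  (x + y) ^+ n / n`!%:R =
  \sum_(i < n.+1) (x ^+ i / i`!%:R) * (y ^+ (n - i) / (n - i)`!%:R).
Proof.
rewrite addrC exprDn mulr_suml; apply: eq_bigr => i _.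
have le_in : (i <= n)%N by rewrite -ltnS.
have f0 k : k`!%:R != 0 :> F by rewrite pnatr_eq0 -lt0n fact_gt0.
rewrite -(bin_fact le_in) !natrM -mulr_natr.
have b0 : 'C(n, i)%:R != 0 :> F by rewrite pnatr_eq0 -lt0n bin_gt0.
by field; rewrite !f0 b0.
Qed.

Section ExponentialSeries.
Variable R : realType.
Local Open Scope complex_scope.
Local Notation normc := (@Normc.normc R).
Variable t : R.

Definition iexp_coeff k : R[i] := (k`!%:R)^-1 * (0 +i* t) ^+ k.

Lemma normc_it : normc (0 +i* t) = `|t|.
Proof. by rewrite /= expr0n add0r sqrtr_sqr. Qed.

Lemma normc_iexp_coeff k : normc (iexp_coeff k) = `|t| ^+ k / k`!%:R.
Proof.
rewrite /iexp_coeff Normc.normcM Normc.normcV normcX normc_it mulrC.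
by rewrite -(rmorph_nat (real_complex R)) normcR normr_nat.
Qed.

(** For the moments [mu] of a real vector x, this is the squared norm of the truncated exp(itA)
    x. *)
Definition iexp_gram (mu : nat -> R) n : R[i] :=
  \sum_(j < n) \sum_(k < n)
    iexp_coeff j * conjc (iexp_coeff k) * (mu (j + k)%N)%:C.

Let P n := \poly_(k < n) iexp_coeff k.
Let Q n := \poly_(k < n) conjc (iexp_coeff k).

(** [P n] and [Q n] truncate exp(itX) and exp(-itX); the linear map sending X^l to [mu l] turns
    their product into the Gram sum. *)
Lemma iexp_gram_poly mu n :
  iexp_gram mu n = \sum_(l < n + n) (P n * Q n)`_l * (mu l)%:C.
Proof.
have -> : P n * Q n = \sum_(j < n) \sum_(k < n)
    (iexp_coeff j * conjc (iexp_coeff k)) *: 'X^(j + k).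
  rewrite /P /Q !poly_def mulr_suml; apply: eq_bigr => j _.
  rewrite mulr_sumr; apply: eq_bigr => k _.
  by rewrite -scalerAl -scalerAr scalerA exprD.
under [RHS]eq_bigr do rewrite coef_sum mulr_suml.
rewrite exchange_big; apply: eq_bigr => j _ /=.
under [RHS]eq_bigr do rewrite coef_sum mulr_suml.
rewrite exchange_big; apply: eq_bigr => k _ /=.
have jk : (j + k < n + n)%N by rewrite -addnS leq_add// ltnW.
rewrite (bigD1 (Ordinal jk))//= coefZ coefXn eqxx mulr1 big1 ?addr0// => l ljk.
rewrite coefZ coefXn; case: eqP => [le|]; last by rewrite mulr0 mul0r.
by move: ljk; rewrite -val_eqE /= le eqxx.
Qed.

Lemma conj_iexp_coeff k :
  conjc (iexp_coeff k) = (k`!%:R)^-1 * (0 -i* t) ^+ k.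
Proof.
rewrite /iexp_coeff rmorphM/= rmorphXn/= conjc_inv conjc_nat.
by [].
Qed.

(** Below n the truncations are invisible, and the coefficient is that of exp(itX - itX) = 1. *)
Lemma coef_lt n l : (l < n)%N -> (P n * Q n)`_l = (l == 0%N)%:R.
Proof.
move=> ln; rewrite coefM.
transitivity (((0 +i* t) + (0 -i* t)) ^+ l / l`!%:R : R[i]).
  rewrite exp_coeff_binomial; apply: eq_bigr => j _.
  have jl : (j <= l)%N by rewrite -ltnS.
  rewrite !coef_poly (leq_ltn_trans jl)// (leq_ltn_trans (leq_subr _ _))//.
  by rewrite conj_iexp_coeff /iexp_coeff ![_^-1 * _]mulrC.
have -> : (0 +i* t) + (0 -i* t) = 0 :> R[i].
  by apply/eqP; rewrite eq_complex /= addr0 subrr eqxx.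
by case: l ln => [|l] _; rewrite ?expr0 ?invr1 ?mulr1// expr0n mul0r.
Qed.

(** Truncation only drops terms, so the coefficients are dominated by those of exp(2|t|X), also from
    n on, where the cancellation is incomplete. *)
Lemma normc_coef_le n l :
  normc (P n * Q n)`_l <= (2 * `|t|) ^+ l / l`!%:R.
Proof.
rewrite coefM (le_trans (normc_sum _ _ _))// mulr_natl mulr2n.
rewrite exp_coeff_binomial; apply: ler_sum => j _.
rewrite Normc.normcM !coef_poly.
have d0 k : 0 <= `|t| ^+ k / k`!%:R by rewrite divr_ge0// exprn_ge0.
apply: ler_pM; rewrite ?normc_ge0//; case: ifP => _;
  by rewrite ?Normc.normc0 ?normc_conj ?normc_iexp_coeff.
Qed.

(** Degree 0 contributes [mu 0], the degrees strictly between 0 and n contribute nothing, and those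
    from n on are bounded by a tail of the series of exp(2|t|M). *)
Lemma iexp_gram_cvg (mu : nat -> R) (N M : R) : 0 <= N -> 0 <= M ->
  (forall l, `|mu l| <= N * M ^+ l) ->
  forall e : R, 0 < e ->
  \forall n \near \oo, normc (iexp_gram mu n - (mu 0%N)%:C) <= e.
Proof.
move=> N0 M0 muM e e0.
have z0 : 0 <= 2 * `|t| * M by rewrite !mulr_ge0.
have d0 : 0 < e / (N + 1) by rewrite divr_gt0// ltr_wpDl.
have [m _ hm] := exp_coeff_tail z0 d0.
(* The successor makes n positive, so that degree 0 falls under [coef_lt]. *)
exists m.+1 => // n /= mn.
have n0 : (0 < n)%N by exact: leq_trans mn.
have {hm} tail_le := hm n (ltnW mn) (n + n)%N.
rewrite iexp_gram_poly -(big_mkord xpredT (fun l => (P n * Q n)`_l * (mu l)%:C)).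
rewrite (@big_cat_nat _ _ _ n)//= ?leq_addr//.
rewrite [X in X + _ - _](_ : _ = (mu 0%N)%:C); last first.
  rewrite big_ltn// coef_lt// mul1r big_nat big1 ?addr0// => l /andP[l0 ln].
  by rewrite coef_lt// gtn_eqF// mul0r.
rewrite (addrC (mu 0%N)%:C) addrK.
apply: (le_trans (normc_sum _ _ _)).
apply: (@le_trans _ _ (N * \sum_(n <= l < n + n) (2 * `|t| * M) ^+ l / l`!%:R)).
  rewrite mulr_sumr; apply: ler_sum => l _; rewrite Normc.normcM normcR.
  apply: (le_trans (ler_pM (normc_ge0 _) (normr_ge0 _) (normc_coef_le n l) (muM l))).
  by rewrite [in leRHS]exprMn le_eqVlt; apply/orP; left; apply/eqP; ring.
apply: (le_trans (ler_wpM2l N0 tail_le)).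
by rewrite mulrA ler_pdivrMr ?ltr_wpDl// mulrC ler_wpM2l ?ltW// ltrDl.
Qed.

(** The scalar case: for the moments [th ^+ l] the Gram sum is the squared modulus of the partial
    sum of exp(it th), and it tends to 1. *)
Lemma normc_iexp_series_cvg (th e : R) : 0 < e -> e <= 1 ->
  \forall n \near \oo,
    1 - e <= normc (\sum_(k < n) iexp_coeff k * (th ^+ k)%:C).
Proof.
move=> e0 e1.
have th_le l : `|th ^+ l| <= 1 * `|th| ^+ l by rewrite normrX mul1r.
apply: filterS (iexp_gram_cvg ler01 (normr_ge0 th) th_le e0) => n.
set z := \sum_(k < n) _.
have -> : iexp_gram (fun l => th ^+ l) n = (normc z ^+ 2)%:C.
  have -> : (normc z ^+ 2)%:C = z * conjc z.
    rewrite sqr_normc_ReIm; case: (z) => x y.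
    by apply/eqP; rewrite eq_complex /=; apply/andP; split; apply/eqP; ring.
  rewrite /iexp_gram /z rmorph_sum mulr_suml; apply: eq_bigr => j _.
  rewrite mulr_sumr; apply: eq_bigr => k _.
  by rewrite [in RHS]rmorphM /= oppr0 complexr0 exprD (rmorphM (real_complex R)) mulrACA.
rewrite -rmorphB normcR /= => /ler_normlP[+ _].
rewrite opprB => H; have z0 := normc_ge0 z.
nra.
Qed.

End ExponentialSeries.

(** * The evolution of finitely supported states through moments *)

Section EvolutionMoments.
Variables (R : realType) (V : countType).
Local Open Scope complex_scope.
Local Notation normc := (@Normc.normc R).
Implicit Types (G H : graph R V) (x : V -> R).

Definition row_bounded G (M : R) :=
  forall a, (\esum_(b in [set: V]) `|G a b|%:E <= M%:E)%E.

(** Cauchy-Schwarz against the truncated evolution of x: its squared norm is a Gram sum, eventually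
    at most dot x x + e. *)
Lemma iexp_moment_le G M t x : 0 < M -> row_bounded G M -> l1 x ->
  forall e : R, 0 < e -> \forall n \near \oo,
  normc (\sum_(k < n) iexp_coeff t k * (dot x (iter k (adjacency G) x))%:C)
    <= dot x x + e.
Proof.
move=> M0 GM xl e e0.
pose y k := iter k (adjacency G) x; pose mu k := dot x (y k).
have yl k : l1 (y k) by exact: (l1_iter_adjacency M0 GM).
have [N N0 muN] := moment_bound M0 GM xl xl.
apply: filterS (iexp_gram_cvg t N0 (ltW M0) muN e0) => n gram_le.
(* With g the real or the imaginary part, [w g] is that part of the truncated evolution, so the real
   [dot] suffices. *)
pose w (g : R[i] -> R) v := \sum_(k < n) g (iexp_coeff t k) * y k v.
have wl g : l1 (w g) by apply: l1_sum => k; exact: l1Z.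
have dot_w g z : l1 z ->
    dot z (w g) = \sum_(k < n) g (iexp_coeff t k) * dot z (y k).
  move=> zl; rewrite dot_sumr//; last by move=> k; exact: l1Z.
  by apply: eq_bigr => k _; rewrite dotZr.
have ww g : dot (w g) (w g) = \sum_(j < n) \sum_(k < n)
    g (iexp_coeff t j) * g (iexp_coeff t k) * mu (j + k)%N.
  rewrite dot_w//; apply: eq_bigr => j _.
  rewrite dotC dot_w// mulr_sumr; apply: eq_bigr => k _.
  by rewrite mulrA (dot_iter_adjacency M0 GM).
have gramE : dot (w (@complex.Re R)) (w (@complex.Re R)) +
    dot (w (@complex.Im R)) (w (@complex.Im R)) =
    complex.Re (iexp_gram t mu n).
  rewrite !ww -big_split /= Re_sum; apply: eq_bigr => j _.
  rewrite -big_split /= Re_sum; apply: eq_bigr => k _.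
  case: (iexp_coeff t j) => a b; case: (iexp_coeff t k) => c d /=.
  by ring.
have mu0 : 0 <= mu 0%N by exact: dot_ge0.
rewrite -(ler_pXn2r (ltn0Sn 1)) ?nnegrE ?normc_ge0 ?addr_ge0 ?(ltW e0)//.
rewrite sqr_normc_ReIm Re_sum Im_sum.
rewrite (_ : \sum_(k < n) _ = dot x (w (@complex.Re R))); last first.
  rewrite dot_w//; apply: eq_bigr => k _.
  by case: (iexp_coeff t k) => c d /=; ring.
rewrite (_ : \sum_(k < n) _ = dot x (w (@complex.Im R))); last first.
  rewrite dot_w//; apply: eq_bigr => k _.
  by case: (iexp_coeff t k) => c d /=; ring.
apply: (le_trans (lerD (cauchy_schwarz xl (wl _)) (cauchy_schwarz xl (wl _)))).
rewrite -mulrDr gramE.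
have := le_trans (Re_le_normc _) gram_le.
rewrite raddfB /= => /ler_normlP[_ Hle].
have {}Hle : complex.Re (iexp_gram t mu n) <= dot x x + e by rewrite addrC -lerBlDr.
apply: (le_trans (ler_wpM2l mu0 Hle)).
by rewrite expr2 ler_wpM2r ?addr_ge0 ?(ltW e0)// lerDl ltW.
Qed.

(** Finite support, listed as coefficients with vertices, turns [cdot] into a finite sum, for which
    convergence at single vertices is enough. *)
Definition fsvec (s : seq (R * V)) (v : V) : R :=
  \sum_(p <- s) p.1 * (v == p.2)%:R.

Lemma l1_fsvec s : l1 (fsvec s).
Proof. by apply: l1_sum => p; exact/l1Z/l1_delta. Qed.

Lemma rsum_fsvec s (h : V -> R) :
  rsum (fun v => fsvec s v * h v) = \sum_(p <- s) p.1 * h p.2.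
Proof.
have dl (p : R * V) : l1 (fun v => (v == p.2)%:R * h v).
  apply: (l1_le (M := `|h p.2|) _ (l1_delta R p.2)) => v.
  by case: eqP => [->|_]; rewrite normrM mulrC// mulrC normr0 mulr0 mul0r.
rewrite (_ : (fun v => _) =
    fun v => \sum_(p <- s) p.1 * ((v == p.2)%:R * h v)); last first.
  apply/funext => v; rewrite mulr_suml.
  by apply: eq_bigr => p _; rewrite mulrA.
rewrite rsum_sum; last by move=> p; exact: l1Z.
by apply: eq_bigr => p _; rewrite rsumZ// rsum_delta.
Qed.

Lemma cdot_fsvec s (y : V -> R[i]) :
  cdot (fun v => (fsvec s v)%:C) y = \sum_(p <- s) p.1%:C * y p.2.
Proof.
apply/eqP; rewrite eq_complex Re_sum Im_sum /cdot /csum /=.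
apply/andP; split; apply/eqP.
- rewrite (_ : (fun a => _) = fun v => fsvec s v * complex.Re (y v)).
    rewrite rsum_fsvec; apply: eq_bigr => p _.
    by case: (y p.2) => c d /=; ring.
  by apply/funext => v; case: (y v) => c d /=; ring.
- rewrite (_ : (fun a => _) = fun v => fsvec s v * complex.Im (y v)).
    rewrite rsum_fsvec; apply: eq_bigr => p _.
    by case: (y p.2) => c d /=; ring.
  by apply/funext => v; case: (y v) => c d /=; ring.
Qed.

Lemma sqnorm_real x : l1 x -> sqnorm (fun v => (x v)%:C) = (dot x x)%:E.
Proof.
move=> xl; have xx := l1M xl xl.
rewrite /dot rsum_ge0E; last by move=> a; rewrite -expr2 sqr_ge0.
rewrite fineK; last first.
  rewrite ge0_fin_numE; last first.
    by apply: esum_ge0 => a _; rewrite lee_fin -expr2 sqr_ge0.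
  by apply: le_lt_trans xx; apply: le_esum => a _; rewrite lee_fin ler_norm.
apply: eq_esum => a _; congr EFin.
by rewrite sqr_normc_ReIm /= expr0n addr0 expr2.
Qed.

Lemma l2_real x : l1 x -> l2 (fun v => (x v)%:C).
Proof.
move=> xl; rewrite /l2 /= /l2norm -/(sqnorm _) sqnorm_real//.
exact/poweR_lty/ltry.
Qed.

Lemma evolution_cvg G M t s : 0 < M -> row_bounded G M ->
  forall e : R, 0 < e -> \forall n \near \oo,
  normc (\sum_(k < n) iexp_coeff t k *
           (dot (fsvec s) (iter k (adjacency G) (fsvec s)))%:C -
         cdot (fun v => (fsvec s v)%:C)
           (evolution G t (fun v => (fsvec s v)%:C))) <= e.
Proof.
move=> M0 GM e e0.
set x := fsvec s; set u := fun v => (x v)%:C.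
have xl : l1 x by exact: l1_fsvec.
pose W := \sum_(p <- s) `|p.1|.
have W0 : 0 <= W by exact: sumr_ge0.
have d0 : 0 < e / (W + 1) by rewrite divr_gt0// ltr_wpDl.
pose B (x : V -> R[i]) a := (0 +i* t) * adj_op G x a.
have K0 : 0 < 2 * (`|t| + 1) * M by rewrite !mulr_gt0// ltr_wpDl.
have cvg a := op_exp_cvg K0 (sqnorm_evolution_generator M0 GM t) a
  (l2_real xl) d0.
have {cvg} : \forall n \near \oo, forall p, p \in s ->
    normc (exp_partial B n u p.2 - evolution G t u p.2) <= e / (W + 1).
  elim: (s) => [|p r IHr]; first by apply: nearW.
  apply: filterS2 (cvg p.2) IHr => n pn rn q.
  by rewrite inE => /orP[/eqP->|/rn].
apply: filterS => n close.
have -> : \sum_(k < n) iexp_coeff t k * (dot x (iter k (adjacency G) x))%:C =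
    \sum_(p <- s) p.1%:C * exp_partial B n u p.2.
  under [RHS]eq_bigr do rewrite mulr_sumr.
  rewrite [RHS]exchange_big; apply: eq_bigr => k _ /=.
  rewrite /dot rsum_fsvec rmorph_sum mulr_sumr; apply: eq_bigr => p _.
  rewrite (iter_evolution_generator M0 GM t k xl) rmorphM /iexp_coeff.
  by rewrite mulrCA -!mulrA.
rewrite cdot_fsvec -sumrB (le_trans (normc_sum _ _ _))//.
apply: (@le_trans _ _ (\sum_(p <- s) `|p.1| * (e / (W + 1)))).
  rewrite big_seq [leRHS]big_seq; apply: ler_sum => p ps.
  by rewrite -mulrBr Normc.normcM normcR ler_wpM2l// close.
rewrite -mulr_suml -/W mulrCA ler_piMr ?(ltW e0)//.
by rewrite ler_pdivrMr ?ltr_wpDl// mul1r lerDl.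
Qed.

(* The state on [H] and the vector [p] on [G] only meet through their moments,
   so that the plus state on the signed graph is compared with the original
   graph. *)
Lemma normc_evolution_ge G H M t s (p : V -> R) (th d : R) :
  0 < M -> row_bounded G M -> row_bounded H M -> l1 p -> 0 <= d <= 1 ->
  (forall k, dot (fsvec s) (iter k (adjacency H) (fsvec s)) =
     dot p (iter k (adjacency G) p) + th ^+ k * d) ->
  d - dot p p <= normc (cdot (fun v => (fsvec s v)%:C)
           (evolution H t (fun v => (fsvec s v)%:C))).
Proof.
move=> M0 GM HM pl /andP[d0 d1] momE; apply/ler_addgt0Pr => e e0.
(* Three approximations are made, for the eigenvalue series, the moments of p and the evolution;
   [normc_iexp_series_cvg] asks for an error of at most 1. *)
pose e' := Num.min (e / 3) 1.
have e'0 : 0 < e' by rewrite lt_min ltr01 divr_gt0.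
have e'1 : e' <= 1 by rewrite ge_min lexx orbT.
have e'e : e' <= e / 3 by rewrite ge_min lexx.
near \oo => n.
have A : 1 - e' <= normc (\sum_(k < n) iexp_coeff t k * (th ^+ k)%:C).
  by near: n; exact: normc_iexp_series_cvg.
have B : normc (\sum_(k < n) iexp_coeff t k *
    (dot p (iter k (adjacency G) p))%:C) <= dot p p + e'.
  by near: n; exact: (iexp_moment_le t M0 GM pl).
have C : normc (\sum_(k < n) iexp_coeff t k *
           (dot (fsvec s) (iter k (adjacency H) (fsvec s)))%:C -
         cdot (fun v => (fsvec s v)%:C)
           (evolution H t (fun v => (fsvec s v)%:C))) <= e'.
  by near: n; exact: (evolution_cvg t s M0 HM).
move: A B C.
have -> : \sum_(k < n) iexp_coeff t k *
    (dot (fsvec s) (iter k (adjacency H) (fsvec s)))%:C =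
    \sum_(k < n) iexp_coeff t k * (dot p (iter k (adjacency G) p))%:C +
    d%:C * \sum_(k < n) iexp_coeff t k * (th ^+ k)%:C.
  rewrite mulr_sumr -big_split; apply: eq_bigr => k _ /=.
  by rewrite momE rmorphD rmorphM mulrDr [_ * d%:C]mulrC mulrCA.
move: (\sum_(k < n) _) (\sum_(k < n) _) (cdot _ _) => Q P w A B C.
have : normc (d%:C * P) <= normc w + normc Q + normc (Q + d%:C * P - w).
  rewrite [X in normc X <= _](_ : _ = w + (- Q) + (Q + d%:C * P - w)); last by ring.
  rewrite (le_trans (le_normcD _ _))// lerD2r.
  by rewrite (le_trans (le_normcD _ _))// normcN.
rewrite Normc.normcM normcR ger0_norm// => low.
have := ler_wpM2l d0 A; have := ler_wpM2r (ltW e'0) d1.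
by clearbody e'; move=> *; lra.
Unshelve. all: by end_near. Qed.

End EvolutionMoments.

(** * Twin vectors and their eigenvector decomposition *)

Section TwinSubgraphs.
Variables (R : realType) (V : countType).
Implicit Types (G : graph R V) (X T : set V) (x p q : V -> R).

Lemma bounded_graph_row G : bounded_graph G ->
  exists2 M : R, 0 < M & row_bounded G M.
Proof.
move=> [_ [M GM]]; exists (Num.max M 1); first by rewrite lt_max ltr01 orbT.
by move=> a; rewrite (le_trans (GM a))// lee_fin le_max lexx.
Qed.

Lemma iter_adjacency_eigen G M q (th : R) k : 0 < M -> row_bounded G M -> l1 q ->
  adjacency G q = (fun v => th * q v) ->
  iter k (adjacency G) q = (fun v => th ^+ k * q v).
Proof.
move=> M0 GM ql qE; elim: k => [|k IHk].
  by apply/funext => v; rewrite mul1r.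
rewrite iterS IHk (adjacencyZ GM)// qE; apply/funext => v.
by rewrite mulrA exprSr.
Qed.

Lemma iter_adjacencyD G M p q k : 0 < M -> row_bounded G M -> l1 p -> l1 q ->
  iter k (adjacency G) (fun v => p v + q v) =
  (fun v => iter k (adjacency G) p v + iter k (adjacency G) q v).
Proof.
move=> M0 GM pl ql; elim: k => // k IHk.
by rewrite !iterS IHk (adjacencyD GM)//; exact: (l1_iter_adjacency M0 GM).
Qed.

(** The cross terms vanish: by self-adjointness, pairing q with an iterate of p gives a multiple of
    dot p q. *)
Lemma moment_split G M p q (th : R) k : 0 < M -> row_bounded G M ->
  l1 p -> l1 q -> adjacency G q = (fun v => th * q v) -> dot p q = 0 ->
  dot (fun v => p v + q v) (iter k (adjacency G) (fun v => p v + q v)) =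
  dot p (iter k (adjacency G) p) + th ^+ k * dot q q.
Proof.
move=> M0 GM pl ql qE pq0.
have pkl : l1 (iter k (adjacency G) p) by exact: (l1_iter_adjacency M0 GM).
have qp : dot q (iter k (adjacency G) p) = 0.
  have := dot_iter_adjacency M0 GM k 0 ql pl.
  rewrite addn0 /= => <-.
  by rewrite (iter_adjacency_eigen k M0 GM ql qE) dotC dotZr// pq0 mulr0.
rewrite (iter_adjacencyD k M0 GM pl ql) (iter_adjacency_eigen k M0 GM ql qE).
have tql : l1 (fun v => th ^+ k * q v) by exact: l1Z.
rewrite dotC dotDr//; last exact: l1D.
rewrite ![dot (fun v => _ + _) _]dotC !dotDr ?dotZr//.
by rewrite qp pq0 mulr0 addr0 add0r.
Qed.

Variables (G : graph R V) (M : R) (X1 X2 T : set V) (f : V -> V).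
Hypothesis M0 : 0 < M.
Hypothesis GM : row_bounded G M.
Hypothesis hX : twin_subgraphs G X1 X2 f.
Hypothesis hT : pairwise_twins G X1 T.

Let TX b : T b -> X1 b. Proof. by case: hT => TX _; exact: TX. Qed.

Let X12 a b : X1 a -> X2 b -> a = b -> False.
Proof.
case: hX => _ [X120 _] _ _ _ X1a X2b ab.
have : (X1 `&` X2) a by split => //; rewrite ab.
by rewrite X120.
Qed.

Let fX b : X1 b -> X2 (f b).
Proof. by case: hX => _ _ [+ _ _] _ _ => /[apply]. Qed.

Let f_inj b b' : X1 b -> X1 b' -> f b = f b' -> b = b'.
Proof.
case: hX => _ _ [_ inj _] _ _ X1b X1b'.
by apply: inj; rewrite inE.
Qed.

Let no_edge a b : X1 a -> X2 b -> G a b = 0.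
Proof.
case: hX => _ [_ ne] _ _ _ X1a X2b.
by apply/eqP; rewrite -[_ == _]negbK; exact: ne.
Qed.

(** The twin condition compares weights at neighbours only; at a non-neighbour, equality of the
    neighbourhoods makes both weights 0. *)
Lemma twin_weights b b' w : T b -> T b' -> X1 w -> b <> b' -> w <> b -> w <> b' ->
  G b w = G b' w.
Proof.
move=> Tb Tb' X1w bb' wb wb'.
have [E Ew] : twins G X1 b b' by case: hT => _; exact.
have [bw|/negPn/eqP bw] := boolP (edge G b w).
  by rewrite ![G _ w]wt_sym; apply: Ew.
rewrite bw; apply/esym/eqP/negPn/negP => b'w.
have : (nbhd G X1 b `\ b') w by rewrite E.
by rewrite /nbhd /edge /= bw eqxx => -[[]].
Qed.

Definition twin_diff b v : R := (v == b)%:R - (v == f b)%:R.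

Lemma l1_twin_diff b : l1 (twin_diff b).
Proof.
apply: l1D; first exact: l1_delta.
rewrite (_ : (fun a => _) = fun a => -1 * (a == f b)%:R).
  exact/l1Z/l1_delta.
by apply/funext => v; rewrite mulN1r.
Qed.

Lemma dot_twin_diff b y : l1 y -> dot (twin_diff b) y = y b - y (f b).
Proof.
move=> yl; rewrite dotC.
rewrite (_ : twin_diff b = fun v => (v == b)%:R + -1 * (v == f b)%:R); last first.
  by apply/funext => v; rewrite mulN1r.
have dl (w : V) : l1 (fun v => (v == w)%:R : R) by exact: l1_delta.
rewrite (dotDr yl (dl b) (l1Z (-1) (dl (f b)))) (dotZr (-1) yl (dl (f b))).
by rewrite (dotC y) dot_delta (dotC y) dot_delta mulN1r.
Qed.

Lemma adjacency_twin_diff b v : adjacency G (twin_diff b) v = G v b - G v (f b).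
Proof.
rewrite (_ : twin_diff b = fun v => (v == b)%:R + -1 * (v == f b)%:R); last first.
  by apply/funext => w; rewrite mulN1r.
rewrite (adjacencyD GM); [|exact: l1_delta|exact/l1Z/l1_delta].
rewrite (adjacencyZ GM); last exact: l1_delta.
by rewrite !adjacency_delta mulN1r.
Qed.

(** For v in X1 the images contribute nothing and twins differ only at b and b'. For v in X2, f
    carries this computation over with the opposite sign. Elsewhere both sides are 0. *)
Lemma adjacency_twin_diffB b b' v : T b -> T b' -> b <> b' ->
  adjacency G (twin_diff b) v - adjacency G (twin_diff b') v =
  - G b b' * (twin_diff b v - twin_diff b' v).
Proof.
move=> Tb Tb' bb'; rewrite !adjacency_twin_diff /twin_diff.
have [X1b X1b'] := (TX Tb, TX Tb').
have inX1 w : X1 w -> G w b - G w b' = - G b b' * ((w == b)%:R - (w == b')%:R).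
  move=> X1w; have [->|/eqP wb] := eqVneq w b.
    by rewrite wt_loopless; case: eqP => // _; rewrite sub0r subr0 mulr1.
  have [->|/eqP wb'] := eqVneq w b'.
    by rewrite wt_loopless subr0 sub0r mulrN1 opprK wt_sym.
  by rewrite subrr mulr0 ![G w _]wt_sym (twin_weights Tb Tb')// subrr.
have [X1v|nX1v] := pselect (X1 v).
  rewrite !(no_edge X1v (fX _))// !subr0 inX1//.
  have vf d : X1 d -> (v == f d) = false.
    by move=> X1d; apply/eqP; apply: X12 => //; exact: fX.
  by rewrite !vf// !subr0.
have vn w : X1 w -> (v == w)%:R = 0 :> R.
  by move=> X1w; case: eqP => // vw; rewrite vw in nX1v.
rewrite (vn b)// (vn b')// !sub0r.
have [X2v|nX2v] := pselect (X2 v).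
  have [w X1w fw] : exists2 w, X1 w & f w = v.
    by case: hX => _ _ [_ _ surj] _ _; have [w] := surj _ X2v; exists w.
  have Gf c : X1 c -> G v (f c) = G w c by move=> X1c; rewrite -fw; case: hX => _ _ _ + _; apply.
  have ef c : X1 c -> (v == f c) = (w == c).
    move=> X1c; rewrite -fw; apply/eqP/eqP => [|->//]; exact: f_inj.
  rewrite (Gf b)// (Gf b')// (ef b)// (ef b')// ![G v _]wt_sym (no_edge X1b X2v) (no_edge X1b' X2v) !sub0r.
  by rewrite -!opprD inX1// mulrN.
have vfn c : X1 c -> (v == f c)%:R = 0 :> R.
  by move=> X1c; case: eqP => // vf; case: nX2v; rewrite vf; exact: fX.
have Gf c : X1 c -> G v (f c) = G v c.
  case: hX => _ _ _ _ out X1c; rewrite ![G v _]wt_sym; apply: out => //.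
  by case.
by rewrite (vfn b)// (vfn b')// (Gf b)// (Gf b')// !subrr mulr0.
Qed.

Variables (a : V) (s : seq V) (c : R).
Hypothesis s_uniq : uniq s.
Hypothesis sT : forall b, b \in s -> T b.
Hypothesis a_s : a \in s.
Hypothesis c2 : c ^+ 2 = 2^-1.

Let m : R := (size s)%:R.

Let m_gt0 : 0 < m.
Proof. by rewrite ltr0n; case: (s) a_s. Qed.

(** [q] is the deviation of [c * twin_diff a] from its average [p]. Only c^2 is prescribed, since
    the plus state leads to c with the sign of [D a]. *)
Let p v := c * (m^-1 * \sum_(b <- s) twin_diff b v).
Let q v := c * (m^-1 * \sum_(b <- s) (twin_diff a v - twin_diff b v)).

(** Any two further twins b, b' see a equally. This gives all differences
    [twin_diff a - twin_diff b] the same eigenvalue. *)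
Lemma twin_weight_const : exists al : R, forall b, T b -> b <> a -> G a b = al.
Proof.
have [[b [Tb ba]]|none] := pselect (exists b, T b /\ b <> a); last first.
  by exists 0 => b Tb ba; case: none; exists b.
exists (G a b) => b' Tb' b'a; have [->//|/eqP bb'] := eqVneq b' b.
rewrite ![G a _]wt_sym; apply: twin_weights => //; try exact: nesym.
exact/TX/sT.
Qed.

Let l1_p : l1 p.
Proof. by do 2!apply: l1Z; apply: l1_sum => b; exact: l1_twin_diff. Qed.

Let l1_twin_diffB b b' : l1 (fun v => twin_diff b v - twin_diff b' v).
Proof.
apply: l1D; first exact: l1_twin_diff.
rewrite (_ : (fun v => _) = fun v => -1 * twin_diff b' v).
  exact/l1Z/l1_twin_diff.
by apply/funext => v; rewrite mulN1r.
Qed.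

Let l1_q : l1 q.
Proof. by do 2!apply: l1Z; apply: l1_sum => b; exact: l1_twin_diffB. Qed.

Lemma adjacency_sum (I : Type) (r : seq I) (y : I -> V -> R) :
  (forall i, l1 (y i)) ->
  adjacency G (fun v => \sum_(i <- r) y i v) = (fun v => \sum_(i <- r) adjacency G (y i) v).
Proof.
move=> yl; elim: r => [|i r IHr].
  apply/funext => v; rewrite big_nil /adjacency -[RHS](rsum0 R V); congr rsum.
  by apply/funext => b; rewrite big_nil mulr0.
under eq_fun do rewrite big_cons.
rewrite (adjacencyD GM)//; last exact: l1_sum.
by rewrite IHr; apply/funext => v; rewrite big_cons.
Qed.

Lemma adjacency_q : exists th : R, adjacency G q = (fun v => th * q v).
Proof.
have [al alE] := twin_weight_const; exists (- al).
rewrite /q (adjacencyZ GM); last by apply: l1Z; apply: l1_sum => b.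
rewrite (adjacencyZ GM); last by apply: l1_sum => b.
rewrite adjacency_sum//; apply/funext => v.
rewrite [RHS]mulrCA; congr (_ * _); rewrite [RHS]mulrCA; congr (_ * _).
rewrite mulr_sumr big_seq [RHS]big_seq; apply: eq_bigr => b /sT Tb.
transitivity (adjacency G (twin_diff a) v - adjacency G (twin_diff b) v).
  rewrite (_ : (fun _ => _) = fun v => twin_diff a v + -1 * twin_diff b v); last first.
    by apply/funext => w; rewrite mulN1r.
  rewrite (adjacencyD GM); [|exact: l1_twin_diff|exact/l1Z/l1_twin_diff].
  by rewrite (adjacencyZ GM) ?mulN1r//; exact: l1_twin_diff.
(* The summand b = a, to which [al] does not apply, is the zero vector. *)
have [->|/eqP ba] := eqVneq b a; first by rewrite !subrr mulr0.
by rewrite adjacency_twin_diffB ?(alE b)//; [exact: sT|exact: nesym].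
Qed.

Lemma pq_twin_diff v : p v + q v = c * twin_diff a v.
Proof.
rewrite /p /q -mulrDr -mulrDr -big_split /=.
under eq_bigr do rewrite addrC subrK.
congr (_ * _); rewrite big_const_seq count_predT iter_addr_0 -mulr_natl mulrA mulVf ?mul1r//.
by rewrite gt_eqF.
Qed.

(** In view of [dot_twin_diff], the twin vectors are orthogonal with squared norm 2. *)
Lemma twin_diff_dual b b' : X1 b -> X1 b' ->
  twin_diff b' b = (b == b')%:R /\ twin_diff b' (f b) = - (b == b')%:R.
Proof.
move=> X1b X1b'; rewrite /twin_diff.
have -> : (b == f b') = false by apply/eqP; exact: X12 X1b (fX X1b').
have -> : (f b == b') = false.
  by rewrite eq_sym; apply/eqP; exact: X12 X1b' (fX X1b).
have -> : (f b == f b') = (b == b') by apply/eqP/eqP => [|->//]; exact: f_inj.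
by rewrite subr0 sub0r.
Qed.

(** The value does not depend on b, so averaging over s gives dot p p, and b = a shows that p has
    the same product with [c * twin_diff a]; hence p is orthogonal to q. *)
Lemma dot_twin_diff_p b : b \in s -> dot (twin_diff b) p = c * (2 / m).
Proof.
move=> bs; rewrite dot_twin_diff// /p.
have X1s b' : b' \in s -> X1 b' by move=> /sT/TX.
have delta : \sum_(b' <- s) (b == b')%:R = 1 :> R.
  rewrite (bigD1_seq b)//= eqxx big1 ?addr0// => b'.
  by rewrite eq_sym => /negPf->.
have -> : \sum_(b' <- s) twin_diff b' b = 1.
  rewrite -delta big_seq [RHS]big_seq; apply: eq_bigr => b' b's.
  by case: (twin_diff_dual (X1s _ bs) (X1s _ b's)).
have -> : \sum_(b' <- s) twin_diff b' (f b) = -1.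
  rewrite -delta -sumrN big_seq [RHS]big_seq; apply: eq_bigr => b' b's.
  by case: (twin_diff_dual (X1s _ bs) (X1s _ b's)).
by ring.
Qed.

Lemma dot_pp : dot p p = m^-1.
Proof.
have m0 : m != 0 by rewrite gt_eqF.
have ul : l1 (fun v => \sum_(b <- s) twin_diff b v).
  by apply: l1_sum => b; exact: l1_twin_diff.
rewrite {2}/p dotZr//; last exact: l1Z.
rewrite dotZr// dot_sumr//; last by move=> b; exact: l1_twin_diff.
rewrite big_seq (eq_bigr (fun=> c * (2 / m))); last first.
  by move=> b bs; rewrite dotC dot_twin_diff_p.
rewrite -big_seq big_const_seq count_predT iter_addr_0 -[_ *+ size s]mulr_natl -/m.
have -> : c * (m^-1 * (m * (c * (2 / m)))) = c ^+ 2 * 2 / m by field.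
by rewrite c2 mulVf ?mul1r// pnatr_eq0.
Qed.

Lemma twin_moments : exists2 th : R, l1 p /\ dot p p = m^-1 &
  forall k, dot (fun v => c * twin_diff a v)
      (iter k (adjacency G) (fun v => c * twin_diff a v)) =
    dot p (iter k (adjacency G) p) + th ^+ k * (1 - m^-1).
Proof.
have [th qE] := adjacency_q; exists th; first by split; [exact: l1_p|exact: dot_pp].
have dl := l1_twin_diff a.
have dp : dot (fun v => c * twin_diff a v) p = m^-1.
  rewrite dotC dotZr// dotC dot_twin_diff_p// mulrA -expr2 c2.
  by rewrite mulrA mulVf ?mul1r// pnatr_eq0.
have dd : dot (fun v => c * twin_diff a v) (fun v => c * twin_diff a v) = 1.
  rewrite dotZr//; last exact: l1Z.
  rewrite dotC dotZr// dot_twin_diff//.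
  have [-> ->] := twin_diff_dual (TX (sT a_s)) (TX (sT a_s)).
  by rewrite eqxx opprK mulrA -expr2 c2 -mulr2n mulVf// pnatr_eq0.
have pqE : (fun v => c * twin_diff a v) = (fun v => p v + q v).
  by apply/funext => v; rewrite pq_twin_diff.
have pq0 : dot p q = 0.
  move: dp; rewrite pqE dotC dotDr// dot_pp => dpE.
  by apply: (addrI m^-1); rewrite addr0.
have qq : dot q q = 1 - m^-1.
  move: dd; rewrite {2}pqE dotDr//; last exact: l1Z.
  rewrite dp pqE dotC dotDr// dotC pq0 add0r => <-.
  by rewrite addrC addKr.
by move=> k; rewrite pqE (moment_split k M0 GM l1_p l1_q qE pq0) qq.
Qed.

End TwinSubgraphs.

(** * Sedentary states, diagonal conjugation and cardinality *)

Section Sedentary.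
Variables (R : realType) (V : countType).
Local Open Scope complex_scope.
Implicit Types (G H : graph R V) (X T : set V) (st : seq (R * V)).

Lemma sedentary_fsvec G st (c : R) : 0 < c <= 1 ->
  dot (fsvec st) (fsvec st) = 1 ->
  (forall t, c <= Normc.normc (cdot (fun v => (fsvec st v)%:C)
                (evolution G t (fun v => (fsvec st v)%:C)))) ->
  sedentary G c (fun v => (fsvec st v)%:C).
Proof.
move=> c01 st1 ge_c; split => //.
  by rewrite /l2norm -/(sqnorm _) (sqnorm_real (l1_fsvec st)) st1 poweR1r.
apply: lb_le_inf; last by move=> _ [t _ <-].
(* A lower bound passes to [inf] for nonempty sets; the time 1 provides a member. *)
by eexists; exists 1 => //; rewrite /= ltr01.
Qed.

Lemma row_bounded_diag_conj G (M : R) (D : V -> R) :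
  (forall v, D v = 1 \/ D v = -1) -> row_bounded G M ->
  row_bounded (diag_conj D G) M.
Proof.
move=> D1 GM v; apply: le_trans (GM v); apply: le_esum => w _.
have nD u : `|D u| = 1 by case: (D1 u) => ->; rewrite ?normrN normr1.
by rewrite /= /diag_conj_wt !normrM !nD mul1r mulr1.
Qed.

(** Inner factors cancel in (DAD)^k, as D squares to the identity. *)
Lemma iter_adjacency_diag_conj G (M : R) (D : V -> R) (x : V -> R) k :
  0 < M -> row_bounded G M -> (forall v, D v = 1 \/ D v = -1) -> l1 x ->
  iter k (adjacency (diag_conj D G)) x =
  (fun v => D v * iter k (adjacency G) (fun w => D w * x w) v).
Proof.
move=> M0 GM D1 xl.
have DD v : D v * D v = 1 by case: (D1 v) => ->; rewrite ?mulrNN mulr1.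
have Dxl : l1 (fun w => D w * x w).
  apply: (l1_le (M := 1) _ xl) => v; rewrite normrM.
  by case: (D1 v) => ->; rewrite ?normrN normr1.
elim: k => [|k IHk]; first by apply/funext => v; rewrite /= mulrA DD mul1r.
rewrite !iterS IHk; apply/funext => v; rewrite {2}/adjacency -rsumZ.
  congr rsum; apply/funext => w; rewrite /= /diag_conj_wt.
  by rewrite -[LHS]mulrA (mulrA (D w)) DD mul1r mulrA.
exact/(l1_adjacency_term GM)/(l1_iter_adjacency M0 GM).
Qed.

Lemma le_inv_card T (a : V) (r : R) : T a ->
  (forall s, uniq s -> (forall b, b \in s -> T b) -> a \in s ->
     1 - 2 / (size s)%:R <= r) ->
  1 - 2 * inv_card T <= r.
Proof.
move=> Ta sr; rewrite /inv_card; case: asboolP => [finT|infT].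
  apply: sr => //; first exact: fset_uniq.
    by move=> b; rewrite in_fset_set// inE.
  by rewrite in_fset_set// inE.
rewrite mulr0 subr0; apply/ler_addgt0Pr => e e0.
(* With at least n + 1 twins the defect 2 / m is below e; [a] is then added to the chosen set, since
   the list must contain it. *)
have [n ne] : exists n, 2 / e < n.+1%:R.
  by exists (Num.truncn (2 / e)); rewrite truncnS_gt.
have [B BT nB] := infinite_set_fset n.+1 infT.
have aBT b : b \in (a |` B)%fset -> T b by rewrite !inE => /orP[/eqP->//|/BT].
rewrite -lerBlDr; apply: le_trans (sr _ (fset_uniq _) aBT (fset1U1 _ _)).
have szB : (n.+1 <= size (a |` B)%fset)%N.
  by rewrite (leq_trans nB)// fsubset_leq_card// fsubsetU1.
rewrite lerD2l lerN2 ler_pdivrMr ?ltr0n ?(leq_trans _ szB)//.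
rewrite mulrC -ler_pdivrMr// (le_trans (ltW ne))// ler_nat.
exact: szB.
Qed.

(** Positivity is where three twins are used: two would give the constant 0. *)
Lemma inv_card_sedentary_range T : (`I_3 #<= T)%card ->
  0 < 1 - 2 * inv_card T :> R /\ 1 - 2 * inv_card T <= 1 :> R.
Proof.
move=> T3; rewrite /inv_card; case: asboolP => [finT|_]; last first.
  by rewrite mulr0 subr0 ltr01.
have k3 : (3 <= #|` fset_set T|)%N.
  have [n Tn] := finT; rewrite (card_fset_set Tn).
  by rewrite -card_le_II -(card_le_eqr Tn).
have k0 : (0 : R) < (#|` fset_set T|)%:R by rewrite ltr0n (leq_trans _ k3).
split; last by rewrite gerBl mulr_ge0// invr_ge0 ltW.
rewrite subr_gt0 ltr_pdivrMr// mul1r.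
by rewrite ltr_nat.
Qed.

Lemma pair_state_fsvec (a b : V) : pair_state a b =
  (fun v => (fsvec [:: ((Num.sqrt 2)^-1, a); (- (Num.sqrt 2)^-1, b)] v)%:C)
  :> (V -> R[i]).
Proof.
apply/funext => v; rewrite /fsvec !big_cons big_nil addr0 /=.
rewrite /pair_state /evec -!(rmorph_nat (real_complex R)) -rmorphB -rmorphM.
by rewrite mulrBr mulNr.
Qed.

Lemma plus_state_fsvec (a b : V) : plus_state a b =
  (fun v => (fsvec [:: ((Num.sqrt 2)^-1, a); ((Num.sqrt 2)^-1, b)] v)%:C)
  :> (V -> R[i]).
Proof.
apply/funext => v; rewrite /fsvec !big_cons big_nil addr0 /=.
rewrite /plus_state /evec -!(rmorph_nat (real_complex R)) -rmorphD -rmorphM.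
by rewrite mulrDr.
Qed.

Lemma inv_sqrt2_sqr : (Num.sqrt 2)^-1 ^+ 2 = 2^-1 :> R.
Proof. by rewrite exprVn sqr_sqrtr. Qed.

Lemma dot_fsvec2 (c d : R) (a b : V) : c ^+ 2 = 2^-1 -> d ^+ 2 = 2^-1 -> a != b ->
  dot (fsvec [:: (c, a); (d, b)]) (fsvec [:: (c, a); (d, b)]) = 1.
Proof.
move=> c2 d2 ab; rewrite /dot rsum_fsvec !big_cons big_nil /fsvec.
rewrite !big_cons !big_nil /= !eqxx (negPf ab) eq_sym (negPf ab).
rewrite !mulr1 !mulr0 !addr0 add0r -!expr2 c2 d2.
by field.
Qed.

End Sedentary.

Theorem theorem7p2 (R : realType) (V : countType) (G : graph R V)
    (X1 X2 : set V) (f : V -> V) (T : set V) (a : V)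
    (hG : bounded_graph G) (hX : twin_subgraphs G X1 X2 f)
    (hT : twin_set G X1 T) (hT3 : (`I_3 #<= T)%card) (ha : T a) :
  let c : R := 1 - 2 * inv_card T in
  sedentary G c (pair_state a (hat X1 X2 f a)) /\
  (forall D : V -> R,
      (forall v, D v = 1 \/ D v = -1) ->
      D a = - D (hat X1 X2 f a) ->
      sedentary (diag_conj D G) c (plus_state a (hat X1 X2 f a))).
Proof.
move=> c.
have [M M0 GM] := bounded_graph_row hG.
have [hT' _] := hT.
have X1a : X1 a by case: hT' => TX _; exact: TX.
have -> : hat X1 X2 f a = f a by rewrite /hat mem_set.
have [c0 c1] := inv_card_sedentary_range R hT3.
have afa : a != f a.
  apply/eqP => afa; case: hX => _ [X120 _] [fX _ _] _ _.
  have : (X1 `&` X2) a by split => //; rewrite afa; exact: fX.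
  by rewrite X120.
(* Both claims reduce to matching moments with [k * twin_diff a] on G, where k is the inverse of
   sqrt 2 up to sign. *)
have main (H : graph R V) (st : seq (R * V)) (k : R) : row_bounded H M ->
    k ^+ 2 = 2^-1 -> dot (fsvec st) (fsvec st) = 1 ->
    (forall n, dot (fsvec st) (iter n (adjacency H) (fsvec st)) =
       dot (fun v => k * twin_diff R f a v)
         (iter n (adjacency G) (fun v => k * twin_diff R f a v))) ->
    sedentary H c (fun v => (fsvec st v)%:C%C).
  move=> HM k2 st1 momE; apply: sedentary_fsvec => //; first by rewrite c0 c1.
  move=> t; apply: (le_inv_card ha) => s s_uniq sT a_s.
  have [th [pl pp] mom] := twin_moments M0 GM hX hT' s_uniq sT a_s k2.
  have s1 : 1 <= (size s)%:R :> R by rewrite ler1n; case: (s) a_s.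
  have s01 : 0 <= (1 - (size s)%:R^-1 : R) <= 1.
    apply/andP; split; last by rewrite gerBl invr_ge0 ler0n.
    by rewrite subr_ge0 invf_le1// (lt_le_trans ltr01).
  have := @normc_evolution_ge R V G H M t st _ th _ M0 GM HM pl s01
    (fun n => etrans (momE n) (mom n)).
  by rewrite pp; apply: le_trans; rewrite le_eqVlt; apply/orP; left; apply/eqP; ring.
have r2 := inv_sqrt2_sqr R.
split.
  rewrite pair_state_fsvec; apply: (main _ _ (Num.sqrt 2)^-1) => //.
    by apply: dot_fsvec2; rewrite ?sqrrN.
  move=> n; set x := fsvec _.
  suff -> : x = (fun v => (Num.sqrt 2)^-1 * twin_diff R f a v) by [].
  by apply/funext => v; rewrite /x /fsvec !big_cons big_nil /twin_diff /=; ring.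
move=> D D1 Da; rewrite plus_state_fsvec.
have DD v : D v * D v = 1 by case: (D1 v) => ->; rewrite ?mulrNN mulr1.
apply: (main _ _ (D a * (Num.sqrt 2)^-1)).
- exact: row_bounded_diag_conj.
- by rewrite exprMn r2 expr2 DD mul1r.
- exact: dot_fsvec2.
move=> n; rewrite (iter_adjacency_diag_conj n M0 GM D1 (l1_fsvec _)).
set x := fsvec _.
(* Since D has opposite signs at a and f a, it turns the plus state into [D a] times the pair
   state. *)
have Dx : (fun w => D w * x w) =
    (fun v => D a * (Num.sqrt 2)^-1 * twin_diff R f a v).
  apply/funext => v; rewrite /x /fsvec !big_cons big_nil /twin_diff /= addr0.
  have [->|va] := eqVneq v a; first by rewrite (negPf afa) /=; ring.
  have [->|vfa] := eqVneq v (f a); first by rewrite Da /=; ring.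
  by rewrite /=; ring.
rewrite -Dx; congr rsum; apply/funext => v.
by rewrite mulrCA mulrA.
Qed.
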